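(* Let $S\subset\mathbb{R}^d$ be compact, $\delta\in(0,1)$, $f\in\mathcal{H}_k$, $B\ge\|f\|_k$, $n\ge1$. Assume $\zeta_t$ is conditionally $\sigma_\zeta$-sub-Gaussian given the past and conditionally independent of the executed location, and that for every $x\in S$, $\Delta f_{P^q_x}:=f(\tilde x^q)-\mathbb{E}_{P^q_x}[f]$ ($\tilde x^q\sim P^q_x$) is $\sigma_q$-sub-Gaussian for a given $\sigma_q>0$. Run uGP-UCB (in the ideal setting where its query model equals $P^q_x$) with $$\beta_t=B+\sigma_\nu\sqrt{2\big(I(\mathbf{y}_{t-1};\tilde{\mathbf f}_{t-1}\mid\{P^q_{x_i}\}_{i=1}^{t-1})+1+\log(1/\delta)\big)},\qquad \sigma_\nu:=\sqrt{\sigma_q^2+\sigma_\zeta^2}.$$ Then there is a universal constant $C>0$ such that, with probability at least $1-\delta$, $$\tilde R_n\le C\sqrt{n\tilde\gamma^q_n}\Big(B+\sigma_\nu\sqrt{\tilde\gamma^q_n+\log(1/\delta)}\Big).$$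
   Context: $k$ is a continuous bounded positive-definite kernel on $\mathbb{R}^d$ with $k(x,x)\le1$, RKHS $\mathcal{H}_k$. $\mathcal{P}$ is the set of Borel probability measures on $\mathbb{R}^d$; $\mu_P:=\int k(\cdot,x)\,dP(x)$; $\tilde k(P,P'):=\langle\mu_P,\mu_{P'}\rangle_k=\iint k(x,x')\,dP(x)dP'(x')$. Setting: at round $t$ the algorithm picks $x_t\in S$, the query is executed at $\tilde x_t\sim P^q_{x_t}$ for a fixed map $x\mapsto P^q_x\in\mathcal{P}$, and $y_t=f(\tilde x_t)+\zeta_t$ is observed. Sub-Gaussian: $\mathbb{E}[e^{\lambda Z}]\le e^{\lambda^2\sigma^2/2}$ for all $\lambda$. uGP-UCB (ideal setting): with $\lambda:=1+2/n$, data $\{(P_i,y_i)\}_{i<t}$ where $P_i:=P^q_{x_i}$, $\tilde{\mathbf k}_{t-1}(P)=[\tilde k(P,P_1),\dots,\tilde k(P,P_{t-1})]^\top$, $[\tilde{\mathbf K}_{t-1}]_{ij}=\tilde k(P_i,P_j)$, posterior mean $\tilde\mu_{t-1}(P)=\tilde{\mathbf k}_{t-1}(P)^\top(\tilde{\mathbf K}_{t-1}+\lambda I)^{-1}\mathbf y_{t-1}$ and variance $\tilde\sigma^2_{t-1}(P)=\tilde k(P,P)-\tilde{\mathbf k}_{t-1}(P)^\top(\tilde{\mathbf K}_{t-1}+\lambda I)^{-1}\tilde{\mathbf k}_{t-1}(P)$, it selects $x_t\in\arg\max_{x\in S}\tilde\mu_{t-1}(P^q_x)+\beta_t\tilde\sigma_{t-1}(P^q_x)$.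 Information gain of measures $P_1,\dots,P_m$: $I(\mathbf y_m;\tilde{\mathbf f}_m\mid\{P_i\}_{i=1}^m)=\frac12\log|I+\lambda^{-1}\tilde{\mathbf K}_m|$ with $[\tilde{\mathbf K}_m]_{ij}=\tilde k(P_i,P_j)$ (zero if $m=0$). $\tilde\gamma^q_n:=\sup\{\frac12\log|I+\lambda^{-1}\tilde{\mathbf K}_{\mathcal R}|:\mathcal R\subset\mathcal P_q,|\mathcal R|=n\}$ where $\mathcal P_q=\{P^q_x:x\in S\}$. Uncertain-inputs regret: $\tilde R_n:=\sum_{t=1}^n\big(\max_{x\in S}\mathbb{E}_{P^q_x}[f]-\mathbb{E}_{P^q_{x_t}}[f]\big)$.
   Formalization: The maximum information gain is taken over n-tuples of measures from P_q with repetitions allowed, instead of sets of n distinct measures; with distinct measures it is undefined when P_q has fewer than n elements, and the bound can fail. *)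

(* Defs.v *)
From HB Require Import structures.
From mathcomp Require Import all_boot all_order all_algebra.
From mathcomp Require Import all_classical all_reals all_analysis.
From mathcomp Require Import measurable_realfun.
Set Implicit Arguments. Unset Strict Implicit. Unset Printing Implicit Defensive.
Import Order.TTheory GRing.Theory Num.Theory.
Import numFieldNormedType.Exports.
Local Open Scope classical_set_scope.
Local Open Scope ring_scope.

Section Defs.
Variables (R : realType) (d : nat).

(* Points of R^d.  For measure theory we use d.-tuple R (product = Borel
   sigma-algebra); for topology we transport to the row space 'rV[R]_d. *)
Definition pt := (d.-tuple R).
Definition rv_of (x : pt) : 'rV[R]_d := \row_i tnth x i.
Definition pt_of (v : 'rV[R]_d) : pt := [tuple v ord0 i | i < d].

Definition pd_kernel (k : pt -> pt -> R) : Prop :=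
  (forall x y, k x y = k y x) /\
  (forall s : seq (pt * R),
      0 <= \sum_(p <- s) \sum_(q <- s) p.2 * q.2 * k p.1 q.1).

(* Pre-RKHS H_0: finite combinations sum_i a_i k(., x_i). *)
Definition h0_eval (k : pt -> pt -> R) (s : seq (pt * R)) (x : pt) : R :=
  \sum_(p <- s) p.2 * k p.1 x.
Definition h0_sqnorm (k : pt -> pt -> R) (s : seq (pt * R)) : R :=
  \sum_(p <- s) \sum_(q <- s) p.2 * q.2 * k p.1 q.1.
Definition h0_sub (s s' : seq (pt * R)) : seq (pt * R) :=
  s ++ map (fun p => (p.1, - p.2)) s'.

(* Moore-Aronszajn construction: f belongs to H_k and ||f||_k <= B iff f is
   the pointwise limit of an H_0-Cauchy sequence of elements of H_0 whose
   H_0-norms are all <= B. *)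
Definition rkhs_norm_le (k : pt -> pt -> R) (f : pt -> R) (B : R) : Prop :=
  0 <= B /\
  exists g : nat -> seq (pt * R),
    (forall m, h0_sqnorm k (g m) <= B ^+ 2) /\
    (forall e : R, 0 < e -> exists N : nat, forall m m' : nat,
        (N <= m)%N -> (N <= m')%N -> h0_sqnorm k (h0_sub (g m) (g m')) <= e) /\
    (forall x, (fun m => h0_eval k (g m) x) @ \oo --> f x).

Definition Exp (P : probability pt R) (f : pt -> R) : R :=
  Rintegral P setT f.

Definition ktil (k : pt -> pt -> R) (P P' : probability pt R) : R :=
  Rintegral P setT (fun a => Rintegral P' setT (fun b => k a b)).

Definition gram (k : pt -> pt -> R) (m : nat) (Ps : 'I_m -> probability pt R)
  : 'M[R]_m := \matrix_(i, j) ktil k (Ps i) (Ps j).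

Definition info_gain (k : pt -> pt -> R) (lam : R) (m : nat)
  (Ps : 'I_m -> probability pt R) : R :=
  2^-1 * ln (\det (1%:M + lam^-1 *: gram k Ps)).

Definition gamma_q (k : pt -> pt -> R) (Pq : pt -> probability pt R)
  (S : set pt) (lam : R) (n : nat) : R :=
  sup [set g | exists xs : 'I_n -> pt,
                 (forall i, S (xs i)) /\ g = info_gain k lam (fun i => Pq (xs i))].

Definition kvec (k : pt -> pt -> R) (m : nat) (Ps : 'I_m -> probability pt R)
  (P : probability pt R) : 'rV[R]_m := \row_i ktil k P (Ps i).
Definition post_mean (k : pt -> pt -> R) (lam : R) (m : nat)
  (Ps : 'I_m -> probability pt R) (ys : 'rV[R]_m) (P : probability pt R) : R :=
  (kvec k Ps P *m invmx (gram k Ps + lam%:M) *m ys^T) ord0 ord0.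
Definition post_var (k : pt -> pt -> R) (lam : R) (m : nat)
  (Ps : 'I_m -> probability pt R) (P : probability pt R) : R :=
  ktil k P P - (kvec k Ps P *m invmx (gram k Ps + lam%:M) *m (kvec k Ps P)^T) ord0 ord0.

Definition G_meas {dO} {Om : measurableType dO} {dT} {T : measurableType dT}
  (G : set (set Om)) (g : Om -> T) : Prop :=
  forall B, measurable B -> G (g @^-1` B).

Definition subgauss_law (Q : probability R R) (s : R) : Prop :=
  forall l : R, (\int[Q]_z (expR (l * z))%:E <= (expR (l ^+ 2 * s ^+ 2 / 2))%:E)%E.

Local Unset Implicit Arguments.
(* history of the ideal uGP-UCB run before round t (rounds indexed from 1):
   measures P_i = P^q_{x_i} and observations y_i, i = 1..t-1 *)
Definition hist_P (Pq : pt -> probability pt R) (Om : Type) (xs : nat -> Om -> pt)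
  (t : nat) (w : Om) : 'I_t.-1 -> probability pt R :=
  fun i => Pq (xs (i : nat).+1 w).
Definition hist_y (Om : Type) (ys : nat -> Om -> R) (t : nat) (w : Om)
  : 'rV[R]_t.-1 := \row_i ys (i : nat).+1 w.

Definition beta_t (k : pt -> pt -> R) (lam : R) (Pq : pt -> probability pt R)
  (Om : Type) (xs : nat -> Om -> pt) (B sig_nu delta : R) (t : nat) (w : Om) : R :=
  B + sig_nu * Num.sqrt (2 * (info_gain k lam (hist_P Pq Om xs t w) + 1
                               + ln (delta^-1))).

Definition ucb (k : pt -> pt -> R) (lam : R) (Pq : pt -> probability pt R)
  (Om : Type) (xs : nat -> Om -> pt) (ys : nat -> Om -> R) (B sig_nu delta : R)
  (t : nat) (w : Om) (x : pt) : R :=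
  post_mean k lam (hist_P Pq Om xs t w) (hist_y Om ys t w) (Pq x)
  + beta_t k lam Pq Om xs B sig_nu delta t w
    * Num.sqrt (post_var k lam (hist_P Pq Om xs t w) (Pq x)).

Definition regret (Pq : pt -> probability pt R) (f : pt -> R) (S : set pt)
  (Om : Type) (xs : nat -> Om -> pt) (n : nat) (w : Om) : R :=
  \sum_(1 <= t < n.+1)
     (sup [set Exp (Pq x) f | x in S] - Exp (Pq (xs t w)) f).

End Defs.
Arguments hist_P {R d}.
Arguments hist_y {R}.
Arguments beta_t {R d}.
Arguments ucb {R d}.
Arguments regret {R d}.

(* Main.v *)
(* The observation noise [f(x~_t) - E f + zeta_t] is conditionally
   sigma_nu-sub-Gaussian, so with [A_t = K_t + lam I] and normalised noise
   [e_t] the process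
     [M_t = exp((|e_t|^2 - e_t A_t^-1 e_t^T) / 2) / sqrt (det A_t)]
   is a supermartingale.  By the Schur complement, one step multiplies [M_t] by
   a one-dimensional Gaussian mixture of exponential increments; the mixing
   variance [lam - 1 + sigma_t^2] is positive because [lam = 1 + 2 / n > 1].
   Ville's inequality keeps all [M_t] below [1 / delta] with probability
   [1 - delta], which together with the bias bound from [||f||_k <= B] yields
   [|mu_t - E_P f| <= beta_t sigma_t] at every measure [P].  Positive
   semidefiniteness of [ktil], the kernel Hilbert space fact behind the bias
   bound, is obtained by integrating the quadratic form of [k] one point at a
   time.  The optimistic choice gives instantaneous regret at most
   [2 beta_t sigma_t], and [sum sigma_t^2] is at most [12 gamma].  When
   [gamma < 1/4] the bound instead follows from
   [|E_P f| <= B sqrt (ktil P P)] and [n ktil P P <= 12 gamma]. *)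
Require Import Defs.
From HB Require Import structures.
From mathcomp Require Import all_boot all_order all_algebra.
From mathcomp Require Import all_classical all_reals all_analysis.
From mathcomp Require Import measurable_realfun.
From mathcomp Require Import ring lra.
Import Order.TTheory GRing.Theory Num.Theory.
Import numFieldNormedType.Exports.
Set Implicit Arguments. Unset Strict Implicit. Unset Printing Implicit Defensive.
Local Open Scope classical_set_scope.
Local Open Scope ring_scope.

(** * Linear algebra of kernel ridge regression over row vectors *)

Section RidgeAlgebra.
Variable R : realFieldType.

(** No Hilbert space is built. Its vectors are formal finite combinations of probability measures,
    points enter as Dirac masses, and [kform] is the inner product; [f] acts on such combinations
    through a limit of elements of the pre-RKHS. Conditional expectations do not appear either: each
    conditional inequality is an inequality between integrals over the events of [F], and
    [mixture_le] upgrades it from indicators to nonnegative functions. The choice [lam = 1 + 2 / n]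
    also controls [ln (det A_t)], which exceeds twice the information gain by [t ln lam <= 2]; this
    surplus is the [+ 1] inside [beta_t]. The target bound has no such [+ 1], and [gamma >= 1/4] is
    what allows it to be absorbed. *)

Definition dotmx m (u v : 'rV[R]_m) : R := (u *m v^T) ord0 ord0.

Lemma dotmxE m (u v : 'rV[R]_m) : dotmx u v = \sum_i u ord0 i * v ord0 i.
Proof. by rewrite /dotmx mxE; apply: eq_bigr => i _; rewrite mxE. Qed.

Lemma dotmxC m (u v : 'rV[R]_m) : dotmx u v = dotmx v u.
Proof. by rewrite !dotmxE; apply: eq_bigr => i _; rewrite mulrC. Qed.

Lemma dotmxDl m (u v w : 'rV[R]_m) : dotmx (u + v) w = dotmx u w + dotmx v w.
Proof. by rewrite /dotmx mulmxDl mxE. Qed.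

Lemma dotmxZl m c (u w : 'rV[R]_m) : dotmx (c *: u) w = c * dotmx u w.
Proof. by rewrite /dotmx -scalemxAl mxE. Qed.

Lemma dotmxDr m (u v w : 'rV[R]_m) : dotmx w (u + v) = dotmx w u + dotmx w v.
Proof. by rewrite dotmxC dotmxDl !(dotmxC w). Qed.

Lemma dotmxZr m c (u w : 'rV[R]_m) : dotmx w (c *: u) = c * dotmx w u.
Proof. by rewrite dotmxC dotmxZl (dotmxC w). Qed.

Lemma dotmx_ge0 m (u : 'rV[R]_m) : 0 <= dotmx u u.
Proof. by rewrite dotmxE sumr_ge0// => i _; rewrite -expr2 sqr_ge0. Qed.

Lemma dotmx_eq0 m (u : 'rV[R]_m) : dotmx u u = 0 -> u = 0.
Proof.
rewrite dotmxE => /eqP; rewrite psumr_eq0; last first.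
  by move=> i _; rewrite -expr2 sqr_ge0.
move=> /allP h; apply/rowP => i; rewrite mxE.
by have := h i (mem_index_enum i); rewrite mulf_eq0 orbb => /eqP.
Qed.

Lemma dotmx_sym m (K : 'M[R]_m) (u v : 'rV[R]_m) : K^T = K ->
  dotmx (u *m K) v = dotmx u (v *m K).
Proof. by move=> sK; rewrite /dotmx trmx_mul sK mulmxA. Qed.

Lemma dotmx_row m p (u v : 'rV[R]_m) (u' v' : 'rV[R]_p) :
  dotmx (row_mx u u') (row_mx v v') = dotmx u v + dotmx u' v'.
Proof. by rewrite /dotmx tr_row_mx mul_row_col mxE. Qed.

Lemma dotmx_scalar (a b : R) : dotmx (a%:M : 'rV_1) (b%:M : 'rV_1) = a * b.
Proof. by rewrite dotmxE big_ord1 !mxE eqxx !mulr1n. Qed.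

(** For [c > 0] evaluate at the vertex [s = b / c]; [c < 0] is impossible, and [c = 0] forces
    [b = 0]. The Cauchy-Schwarz inequalities below come from here. *)
Lemma discr_le (a b c : R) : (forall s, 0 <= a - 2 * s * b + s ^+ 2 * c) ->
  b ^+ 2 <= a * c.
Proof.
move=> h; have := h 0; rewrite mulr0 mul0r expr0n mul0r subr0 addr0 => a0.
have [c0|c0|c0] := ltrgt0P c.
- have := h (b / c); set t := b / c => ht.
  have bE : b = t * c by rewrite /t divfK// gt_eqF.
  rewrite bE in ht *; have : 0 <= (a - t ^+ 2 * c) * c.
    by rewrite mulr_ge0 ?(ltW c0)//; apply: le_trans ht _; rewrite le_eqVlt; apply/orP; left; apply/eqP; ring.
  by move=> h1; rewrite -subr_ge0; apply: le_trans h1 _; rewrite le_eqVlt; apply/orP; left; apply/eqP; ring.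
(* The values at [t] and [-t] add up to [2 (a + t^2 c)], which is negative because
   [t c = c - (1 + a)] and [t >= 1]. *)
- exfalso; pose t := 1 + (1 + a) / - c.
  have h1 := h t; have h2 := h (- t).
  have tc : t * c = c - (1 + a).
    by rewrite /t mulrDl mul1r invrN mulrN mulNr divfK// lt_eqF.
  have t1 : 0 <= (t - 1) * (1 + a - c).
    rewrite mulr_ge0//; last lra.
    by rewrite /t addrC addKr divr_ge0 ?oppr_ge0 ?ltW//; lra.
  have e2 : t ^+ 2 * c = t * (t * c) by ring.
  rewrite tc in e2; lra.
- rewrite c0 mulr0; have [b0|b0] := eqVneq b 0; first by rewrite b0 expr0n.
  have := h ((a + 1) / b); rewrite c0 mulr0 addr0 -mulrA divfK// => h1.
  exfalso; lra.
Qed.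

Section Schur.
Variables (m : nat) (A : 'M[R]_m) (kv : 'rV[R]_m) (c : R).
Hypotheses (uA : A \in unitmx) (sA : A^T = A).

Let s := c - dotmx (kv *m invmx A) kv.
Let Ab : 'M[R]_(m + 1) := block_mx A kv^T kv c%:M.

(** Block elimination of the last row; [s] is the Schur complement of [A]. *)
Lemma det_bordered : \det Ab = \det A * s.
Proof.
have -> : Ab = block_mx 1%:M 0 (kv *m invmx A) 1%:M *m block_mx A kv^T 0 s%:M.
  rewrite mulmx_block !mul1mx !mul0mx !addr0 mulmxKV// /Ab.
  congr block_mx; apply/matrixP => i j; rewrite !ord1 !mxE eqxx !mulr1n.
  rewrite /s /dotmx mxE; set S := \sum_j0 _; ring.
by rewrite det_mulmx det_lblock det_ublock !det1 !mul1r det_scalar1.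
Qed.

Hypothesis s0 : s != 0.

Lemma unit_bordered : Ab \in unitmx.
Proof. by rewrite unitmxE det_bordered unitrM -unitmxE uA unitfE. Qed.

(** Solving the bordered system by elimination, the last unknown [x2] is the prediction error of [x]
    divided by the Schur complement, so the form grows by one squared innovation. *)
Lemma quad_bordered (e : 'rV[R]_m) (x : R) :
  dotmx (row_mx e x%:M *m invmx Ab) (row_mx e x%:M) =
  dotmx (e *m invmx A) e + (x - dotmx (kv *m invmx A) e) ^+ 2 / s.
Proof.
pose x2 := (x - dotmx (kv *m invmx A) e) / s.
pose x1 := (e - x2 *: kv) *m invmx A.
have sAi : (invmx A)^T = invmx A by rewrite trmx_inv sA.
have E : row_mx x1 x2%:M *m Ab = row_mx e x%:M.
  rewrite /Ab mul_row_block /x1 mulmxKV// mul_scalar_mx subrK; congr row_mx.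
  apply/matrixP => i j; rewrite !ord1 [in LHS]mxE.
  have -> : ((e - x2 *: kv) *m invmx A *m kv^T) ord0 ord0 =
     dotmx (kv *m invmx A) e - x2 * dotmx (kv *m invmx A) kv.
    rewrite -/(dotmx _ kv) mulmxBl -scalemxAl -scaleN1r dotmxDl !dotmxZl.
    by rewrite (dotmx_sym e kv sAi) dotmxC mulN1r.
  rewrite -scalar_mxM !mxE eqxx !mulr1n.
  have -> : x2 * c = x2 * s + x2 * dotmx (kv *m invmx A) kv by rewrite /s; ring.
  rewrite {2}/x2 divfK//; ring.
rewrite -{1}E mulmxK ?unit_bordered//.
rewrite dotmx_row dotmx_scalar /x1 mulmxBl -scalemxAl -scaleN1r dotmxDl !dotmxZl.
rewrite /x2.
by field.
Qed.

End Schur.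

Section Ridge.
Variables (m : nat) (K : 'M[R]_m) (lam : R).
Hypotheses (sK : K^T = K) (pK : forall v : 'rV[R]_m, 0 <= dotmx (v *m K) v).
Hypothesis lam0 : 0 < lam.
Let A := K + lam%:M.

Lemma ridge_sym : A^T = A.
Proof. by rewrite /A linearD/= sK tr_scalar_mx. Qed.

Lemma ridge_unit : A \in unitmx.
Proof.
rewrite -row_free_unit; apply: inj_row_free => v vA.
have : dotmx (v *m A) v = 0 by rewrite vA /dotmx mul0mx mxE.
rewrite /A mulmxDr mul_mx_scalar dotmxDl dotmxZl => h.
apply: dotmx_eq0; have := pK v; have := dotmx_ge0 v.
move: (dotmx (v *m K) v) (dotmx v v) h => x y h y0 x0.
have ly : 0 <= lam * y by rewrite mulr_ge0// ltW.
have /eqP : lam * y = 0 by lra.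
by rewrite mulf_eq0 gt_eqF//= => /eqP.
Qed.

Variables (kv : 'rV[R]_m) (kp : R).
(** The expression is [|phi - sum a_i phi_i|^2] for a new feature [phi] with [kv_i = <phi, phi_i>]
    and [kp = |phi|^2]. *)
Hypothesis pb : forall a : 'rV[R]_m,
  0 <= kp - 2 * dotmx a kv + dotmx (a *m K) a.

Let a := kv *m invmx A.
Let var := kp - dotmx (kv *m invmx A) kv.

(** The normal equations [kv = a A] exhibit the posterior variance as the minimum, attained at [a],
    of the squared distance plus the penalty [lam |a|^2]. *)
Lemma ridge_varE : var = (kp - 2 * dotmx a kv + dotmx (a *m K) a) + lam * dotmx a a.
Proof.
have : dotmx a kv = dotmx (a *m K) a + lam * dotmx a a.
  have {1}-> : kv = a *m A by rewrite /a mulmxKV// ridge_unit.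
  by rewrite /A mulmxDr mul_mx_scalar dotmxDr dotmxZr -dotmx_sym.
rewrite /var -/a => h; rewrite h; ring.
Qed.

Lemma ridge_var_ge0 : 0 <= var.
Proof. by rewrite ridge_varE addr_ge0// mulr_ge0 ?(ltW lam0) ?dotmx_ge0. Qed.

Lemma ridge_var_le : var <= kp.
Proof.
have : dotmx a kv = dotmx (a *m K) a + lam * dotmx a a.
  have {1}-> : kv = a *m A by rewrite /a mulmxKV// ridge_unit.
  by rewrite /A mulmxDr mul_mx_scalar dotmxDr dotmxZr -dotmx_sym.
rewrite /var -/a => ->; rewrite gerBl addr_ge0//.
by rewrite mulr_ge0 ?(ltW lam0) ?dotmx_ge0.
Qed.

(** The residual is taken at the ridge weights [a], where the squared distance is [var] without its
    penalty term. *)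
Lemma ridge_bias (B fP : R) (fv : 'rV[R]_m) :
  (forall b : 'rV[R]_m, (fP - dotmx b fv) ^+ 2 <=
     B ^+ 2 * (kp - 2 * dotmx b kv + dotmx (b *m K) b)) ->
  (fP - dotmx (kv *m invmx A) fv) ^+ 2 <= B ^+ 2 * var.
Proof.
move=> h; apply: le_trans (h _) _; rewrite ler_wpM2l ?sqr_ge0// ridge_varE.
by rewrite lerDl mulr_ge0 ?(ltW lam0) ?dotmx_ge0.
Qed.

(* With [u = e A^-1] and [a = kv A^-1], the polynomial whose discriminant is taken is
   [|h - s v|^2 + lam |a - s u K / lam|^2], where [h] is the residual of the
   new feature on the old ones and [v] the combination of the features with weights [u]. *)
Lemma ridge_noise (e : 'rV[R]_m) : 1 <= lam ->
  (dotmx (kv *m invmx A) e) ^+ 2 <= var * (dotmx e e - dotmx (e *m invmx A) e).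
Proof.
move=> lam1; set u := e *m invmx A.
have eE : e = u *m K + lam *: u.
  by rewrite -mul_mx_scalar -mulmxDr -/A /u mulmxKV// ridge_unit.
have sAi : (invmx A)^T = invmx A by rewrite trmx_inv ridge_sym.
have NE : dotmx (kv *m invmx A) e = dotmx u kv.
  by rewrite (dotmx_sym kv e sAi) dotmxC.
(* [C] is [|v|^2 + |u K|^2 / lam], the coefficient of [s^2]; in the linear coefficient the terms in
   [a] cancel and leave the product of [u] and [kv]. *)
pose C := dotmx (u *m K) u + dotmx (u *m K) (u *m K) / lam.
have NC : dotmx u kv ^+ 2 <= var * C.
  apply: discr_le => s.
  have h1 := pb (a + s *: u); have h2 := dotmx_ge0 (a - (s / lam) *: (u *m K)).
  have {}h2 : 0 <= lam * dotmx (a - (s / lam) *: (u *m K)) (a - (s / lam) *: (u *m K)).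
    by rewrite mulr_ge0// ltW.
  apply: le_trans (addr_ge0 h1 h2) _; rewrite le_eqVlt; apply/orP; left; apply/eqP.
  rewrite ridge_varE mulmxDl -scalemxAl -(scaleN1r ((s / lam) *: _)) scalerA.
  rewrite !(dotmxDl, dotmxDr, dotmxZl, dotmxZr) /C.
  rewrite (dotmxC (u *m K) a) (dotmx_sym a u sK) .
  by field; rewrite gt_eqF.
rewrite NE; apply: le_trans NC _; rewrite ler_wpM2l ?ridge_var_ge0//.
(* With [x], [y], [z] as named below, the right factor exceeds [C] by [(1 - 1/lam) x + 2 (lam - 1) z
   + lam (lam - 1) y], which is where [lam >= 1] enters. *)
rewrite {1 2 3}eE !(dotmxDl, dotmxDr, dotmxZl, dotmxZr) /C.
rewrite (dotmxC u (u *m K)).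
have := pK u; have := dotmx_ge0 u; have := dotmx_ge0 (u *m K).
move: (dotmx (u *m K) (u *m K)) (dotmx u u) (dotmx (u *m K) u) => x y z x0 y0 z0.
have h1 : x / lam <= x by rewrite ler_pdivrMr// ler_peMr.
have h2 : 0 <= (lam - 1) * z by rewrite mulr_ge0// subr_ge0.
have h3 : 0 <= lam * ((lam - 1) * y) by rewrite !mulr_ge0 ?subr_ge0// ltW.
have -> : x + lam * z + lam * (z + lam * y) - (z + lam * y) =
  x + z + 2 * ((lam - 1) * z) + lam * ((lam - 1) * y) by ring.
lra.
Qed.

End Ridge.

(** The identity bordered by ones with corner [-1/c] is eliminated from either end, and the two
    values of its determinant are compared. *)
Lemma det_rank1 (n : nat) (c : R) :
  \det (1%:M + c *: (const_mx 1 : 'M[R]_n)) = 1 + n%:R * c.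
Proof.
pose u : 'rV[R]_n := const_mx 1.
have h := @det_bordered n 1%:M u (- c)^-1.
have [->|c0] := eqVneq c 0; first by rewrite scale0r mulr0 !addr0 det1.
have J : const_mx 1 = u^T *m u.
  by apply/matrixP => i j; rewrite !mxE big_ord1 !mxE mulr1.
have E : block_mx 1%:M u^T u ((- c)^-1)%:M =
   block_mx 1%:M (- c *: u^T) 0 1%:M *m
   block_mx (1%:M + c *: const_mx 1) 0 u ((- c)^-1)%:M.
  rewrite mulmx_block !mul1mx !mul0mx !add0r mul_mx_scalar -scalemxAl -J scalerA.
  by rewrite mulVf ?oppr_eq0// scale1r scaleNr addrK.
move: h; rewrite unitmx1 => /(_ isT); rewrite E det_mulmx det_ublock det_lblock !det1.
rewrite !mul1r det_scalar1 invmx1 mulmx1 => h.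
have uu : dotmx u u = n%:R.
  by rewrite dotmxE (eq_bigr (fun=> 1)) ?sumr_const ?card_ord// => i _; rewrite !mxE mulr1.
rewrite uu in h; have cc : (- c)^-1 != 0 by rewrite invr_eq0 oppr_eq0.
by apply: (mulIf cc); rewrite h; field.
Qed.

End RidgeAlgebra.

(** * Integrals of bounded measurable functions *)

Section BoundedIntegral.
Context {R : realType} {dT : measure_display} {T : measurableType dT}.
Variable P : probability T R.
Implicit Types h g : T -> R.

(** A class stable under sums, products and slices and integrable for every probability measure, so
    that linearity and Fubini carry no further side conditions. *)
Definition bmeas h := measurable_fun setT h /\ exists M : R, forall x, `|h x| <= M.

Lemma bmeas_integrable h : bmeas h -> P.-integrable setT (EFin \o h).
Proof.
move=> [mh [M hM]]; apply: measurable_bounded_integrable => //.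
  exact: (le_lt_trans (probability_le1 P measurableT) (ltry _)).
exists M; split; first exact: num_real.
by move=> y My x _; apply: le_trans (hM x) (ltW My).
Qed.

Lemma bmeas_cst c : bmeas (fun=> c).
Proof. by split; [exact: measurable_cst|exists `|c|]. Qed.

Lemma bmeasD h g : bmeas h -> bmeas g -> bmeas (fun x => h x + g x).
Proof.
move=> [mh [M hM]] [mg [N gN]]; split; first exact: measurable_funD.
by exists (M + N) => x; apply: le_trans (ler_normD _ _) (lerD _ _).
Qed.

Lemma bmeasM h g : bmeas h -> bmeas g -> bmeas (fun x => h x * g x).
Proof.
move=> [mh [M hM]] [mg [N gN]]; split; first exact: measurable_funM.
by exists (M * N) => x; rewrite normrM ler_pM.
Qed.

Lemma bmeas_sum (I : Type) (s : seq I) (F : I -> T -> R) :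
  (forall i, bmeas (F i)) -> bmeas (fun x => \sum_(i <- s) F i x).
Proof.
move=> h; elim: s => [|i s ih].
  by under eq_fun do rewrite big_nil; exact: bmeas_cst.
by under eq_fun do rewrite big_cons; exact: bmeasD.
Qed.

Local Notation "'\E' h" := (Rintegral P setT h) (at level 10, h at level 8).

Lemma Rint_cst c : \E (fun=> c) = c.
Proof. by rewrite Rintegral_cst//= probability_setT/= mulr1. Qed.

Lemma RintD h g : bmeas h -> bmeas g -> \E (fun x => h x + g x) = \E h + \E g.
Proof. by move=> bh bg; rewrite -RintegralD//; exact: bmeas_integrable. Qed.

Lemma RintZ c h : bmeas h -> \E (fun x => c * h x) = c * \E h.
Proof. by move=> bh; rewrite -RintegralZl//; exact: bmeas_integrable. Qed.

Lemma Rint_sum (I : Type) (s : seq I) (F : I -> T -> R) :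
  (forall i, bmeas (F i)) ->
  \E (fun x => \sum_(i <- s) F i x) = \sum_(i <- s) \E (F i).
Proof.
move=> h; elim: s => [|i s ih].
  by rewrite big_nil -[RHS]Rint_cst; apply: eq_Rintegral => x _; rewrite big_nil.
rewrite big_cons -ih -RintD//; last exact: bmeas_sum.
by apply: eq_Rintegral => x _; rewrite big_cons.
Qed.

Lemma Rint_le h g : bmeas h -> bmeas g -> (forall x, h x <= g x) -> \E h <= \E g.
Proof.
move=> bh bg hg; rewrite -subr_ge0 -mulN1r -RintZ// -RintD//; last first.
  by apply: bmeasM => //; exact: bmeas_cst.
by apply: Rintegral_ge0 => x _; rewrite mulN1r subr_ge0.
Qed.

Lemma Rint_norm_le h M : bmeas h -> (forall x, `|h x| <= M) -> `|\E h| <= M.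
Proof.
move=> bh hM; rewrite ler_norml -{1}(Rint_cst (- M)) -{2}(Rint_cst M).
by apply/andP; split; apply: Rint_le => //; try exact: bmeas_cst;
  move=> x; have := hM x; rewrite ler_norml => /andP[].
Qed.

Lemma EFin_Rint h : bmeas h -> (\int[P]_x (h x)%:E)%E = (\E h)%:E.
Proof.
by move=> bh; rewrite /Rintegral fineK//; apply: integrable_fin_num => //;
  exact: bmeas_integrable.
Qed.

Lemma Rint_cvg (h : nat -> T -> R) (g : T -> R) M :
  (forall m, measurable_fun setT (h m)) -> (forall m x, `|h m x| <= M) ->
  (forall x, h ^~ x @ \oo --> g x) ->
  (fun m => \E (h m)) @ \oo --> \E g.
Proof.
move=> mh hM hg.
have mg : measurable_fun setT g.
  by apply: (@measurable_fun_cvg _ _ _ setT h g) => // x _; exact: hg.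
have gM x : `|g x| <= M.
  apply: (ler_cvg_to (cvg_norm (hg x)) (@cvg_cst _ M _ _ _)).
  by near=> m; exact: hM.
have bh m : bmeas (h m) by split => //; exists M.
have bg : bmeas g by split => //; exists M.
have : (fun m => \int[P]_x (h m x)%:E)%E @ \oo --> (\int[P]_x (g x)%:E)%E.
  apply: (dominated_cvg measurableT (g := fun=> M%:E)).
  - by move=> m; exact/measurable_EFinP.
  - by move=> x _; apply/fine_cvgP; split; [near=> m|exact: hg].
  - by [].
  - exact: (bmeas_integrable (bmeas_cst M)).
  - by move=> m x _; rewrite lee_fin.
rewrite EFin_Rint//; under eq_cvg do rewrite EFin_Rint//.
by move=> /fine_cvgP[].
Unshelve. all: by end_near. Qed.

End BoundedIntegral.

(** * Slices, Markov kernels and Fubini *)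

Section Slices.
Context {R : realType} {d1 d2 : measure_display}
  {T1 : measurableType d1} {T2 : measurableType d2}.
Variables (P1 : probability T1 R) (P2 : probability T2 R).

Lemma bmeas_pair1 (h : T1 * T2 -> R) x : bmeas h -> bmeas (fun y => h (x, y)).
Proof.
move=> [mh [M hM]]; split; last by exists M => y.
exact: measurableT_comp mh (measurable_pair1 _).
Qed.

Lemma bmeas_pair2 (h : T1 * T2 -> R) y : bmeas h -> bmeas (fun x => h (x, y)).
Proof.
move=> [mh [M hM]]; split; last by exists M => x.
exact: measurableT_comp mh (measurable_pair2 _).
Qed.

End Slices.

Section KernelIntegral.
Context {R : realType} {d1 d2 : measure_display}
  {T1 : measurableType d1} {T2 : measurableType d2}.
Variable l : T1 -> probability T2 R.
Hypothesis ml : forall U, measurable U -> measurable_fun setT (fun x => l x U : \bar R).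

Let kl : T1 -> {measure set T2 -> \bar R} := l.
HB.instance Definition _ := isKernel.Build _ _ T1 T2 R kl ml.
HB.instance Definition _ := Kernel_isProbability.Build _ _ T1 T2 R kl
  (fun x => @probability_setT _ _ _ (l x)).

Lemma bmeas_kernel (h : T1 * T2 -> R) : bmeas h ->
  bmeas (fun x => Rintegral (l x) setT (fun y => h (x, y))).
Proof.
move=> bh; have [mh [M hM]] := bh; split; last first.
  by exists M => x; apply: Rint_norm_le => //; exact: bmeas_pair1.
(* Measurability of a kernel integral is applied to a nonnegative integrand, hence the shift by [M];
   it is subtracted afterwards, each [l x] having mass one. *)
pose g z := h z + M.
have bg : bmeas g by apply: bmeasD => //; exact: bmeas_cst.
have g0 z : (0 <= (g z)%:E)%E.
  by rewrite lee_fin /g; have := hM z; rewrite ler_norml => /andP[]; lra.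
have mI : measurable_fun setT (fun x => \int[kl x]_y (g (x, y))%:E)%E.
  apply: (@measurable_fun_integral_finite_kernel _ _ _ _ _ (EFin \o g)) => //.
  by apply/measurable_EFinP; exact: bg.1.
have := measurableT_comp (@fine_measurable R setT measurableT) mI.
move=> /(measurable_funB)/(_ (@measurable_cst _ _ _ _ setT M)).
congr measurable_fun; apply/funext => x /=.
rewrite (@EFin_Rint _ _ _ (l x) (fun y => g (x, y)))/=; last exact: bmeas_pair1.
rewrite /g (RintD _ (bmeas_pair1 x bh))/= ?Rint_cst ?addrK//; exact: bmeas_cst.
Qed.

End KernelIntegral.

Section Fubini.
Context {R : realType} {d1 d2 : measure_display}
  {T1 : measurableType d1} {T2 : measurableType d2}.
Variables (P1 : probability T1 R) (P2 : probability T2 R).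

Lemma Rint_fubini (h : T1 * T2 -> R) : bmeas h ->
  Rintegral P1 setT (fun x => Rintegral P2 setT (fun y => h (x, y))) =
  Rintegral P2 setT (fun y => Rintegral P1 setT (fun x => h (x, y))).
Proof.
move=> bh; have [_ [M hM]] := bh.
have F1 : bmeas (fun x => Rintegral P2 setT (fun y => h (x, y))).
  by have := @bmeas_kernel R _ _ T1 T2 (fun=> P2) (fun U mU => @measurable_cst _ _ _ _ setT _) h bh.
have F2 : bmeas (fun y => Rintegral P1 setT (fun x => h (x, y))).
  have bh' : bmeas (fun z : T2 * T1 => h (z.2, z.1)).
    split; last by exists M => z.
    exact: (measurableT_comp bh.1 (measurable_fun_pair measurable_snd measurable_fst)).
  by have := @bmeas_kernel R _ _ T2 T1 (fun=> P1) (fun U mU => @measurable_cst _ _ _ _ setT _) _ bh'.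
apply: EFin_inj; rewrite -!EFin_Rint//.
under eq_integral => x _ do rewrite -(EFin_Rint _ (bmeas_pair1 x bh)).
under [RHS]eq_integral => y _ do rewrite -(EFin_Rint _ (bmeas_pair2 y bh)).
have := @Fubini _ _ _ _ _ P1 P2 (EFin \o h); apply.
apply: measurable_bounded_integrable => //; last first.
  exists M; split; first exact: num_real.
  by move=> y My x _; apply: le_trans (hM x) (ltW My).
- exact: bh.1.
have := @product_measure1E _ _ T1 T2 R P1 P2 setT setT measurableT measurableT.
rewrite setXTT => E; rewrite [X in (X < _)%E]E.
apply: lte_mul_pinfty; [exact: measure_ge0|exact: fin_num_measure|].
exact: (le_lt_trans (probability_le1 P2 measurableT) (ltry _)).
Qed.
End Fubini.

(** * Continuous kernels are measurable for the product sigma-algebra *)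

Section ContinuousMeasurable.
Variables (R : realType) (d : nat).

Lemma pt_of_rv (x : pt R d) : pt_of (rv_of x) = x.
Proof. by apply: eq_from_tnth => i; rewrite tnth_mktuple mxE. Qed.

Let rv2 (z : pt R d * pt R d) : 'rV[R]_d * 'rV[R]_d := (rv_of z.1, rv_of z.2).

(** Balls of the row space are boxes, so the preimage is a finite intersection over coordinates. *)
Lemma measurable_preimage_rv_ball (q : 'rV[R]_d) (e : R) :
  measurable (@rv_of R d @^-1` ball q e).
Proof.
have [e0|e0] := ltP 0 e; last first.
  rewrite (_ : _ @^-1` _ = set0)//; apply/seteqP; split=> // x [].
  by rewrite ltNge e0.
rewrite (_ : _ @^-1` _ = \bigcap_(i in [set: 'I_d])
    ((fun x : pt R d => tnth x i) @^-1` ball (q ord0 i) e)).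
  apply: fin_bigcap_measurable => // i _.
  rewrite -[X in measurable X]setTI; apply: measurable_tnth => //.
  exact: measurable_ball.
apply/seteqP; split=> x.
  by move=> [_ h] i _; have := h ord0 i; rewrite /= mxE.
by move=> h; split=> // i j; rewrite ord1 mxE; exact: h.
Qed.

(** An open set is the countable union of the balls with rational centre and radius [1 / (n + 1)]
    that it contains, and these are products of boxes. *)
Lemma measurable_preimage_rv_open (O : set ('rV[R]_d * 'rV[R]_d)) :
  open O -> measurable (rv2 @^-1` O).
Proof.
move=> oO.
pose rq (q : 'rV[rat]_d) : 'rV[R]_d := map_mx ratr q.
pose Q := ('rV[rat]_d * 'rV[rat]_d * nat)%type.
pose U (q : Q) : set ('rV[R]_d * 'rV[R]_d) :=
  ball (rq q.1.1, rq q.1.2) q.2.+1%:R^-1.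
have -> : rv2 @^-1` O = \bigcup_(q : Q) (if pselect (U q `<=` O) then rv2 @^-1` U q else set0).
  apply/seteqP; split=> [z Oz|z [q _]]; last by case: pselect => // h /h.
  have /nbhs_ballP[e /= e0 eO] : nbhs (rv2 z) O by exact: open_nbhs_nbhs.
  (* This gives [2 / (n + 1) <= e]: a ball of radius [1 / (n + 1)] whose centre is that close to the
     point stays in the [e]-ball. *)
  pose n := Num.truncn (2 / e).
  have n0 : (0 : R) < n.+1%:R^-1 by rewrite invr_gt0 ltr0n.
  have ne : n.+1%:R^-1 + n.+1%:R^-1 <= e.
    have : 2 / e < n.+1%:R by apply: truncnS_gt.
    rewrite ltr_pdivrMr// => h.
    rewrite (_ : _ + _ = 2 / n.+1%:R); last by rewrite mulr2n mulrDl mul1r.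
    rewrite ler_pdivrMr ?ltr0n//.
    by rewrite mulrC ltW.
  have ex (x : pt R d) : exists q : 'rV[rat]_d, ball (rq q) n.+1%:R^-1 (rv_of x).
    have h (i : 'I_d) : {q : rat | `|ratr q - tnth x i| < n.+1%:R^-1}.
      have := @rat_in_itvoo R (tnth x i - n.+1%:R^-1) (tnth x i + n.+1%:R^-1).
      move=> /(_ _)/cid[|q]; first by rewrite ltrBlDr -addrA ltrDl addr_gt0.
      by rewrite in_itv/= => qE; exists q; rewrite ltr_distl.
    exists (\row_i sval (h i)); split=> // i j; rewrite ord1 !mxE.
    exact: svalP (h j).
  have [q1 hq1] := ex z.1; have [q2 hq2] := ex z.2.
  exists (q1, q2, n) => //; case: pselect => [UO|nU]; first by split.
  exfalso; apply: nU => u Uu; apply: eO; apply: (le_ball ne).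
  apply: (@ball_triangle _ _ (rq q1, rq q2)) => //; apply: ball_sym.
  by split.
apply: countable_bigcupT_measurable; first exact: countableP.
move=> q; case: pselect => UO /=; last by [].
rewrite (_ : rv2 @^-1` U q = (@rv_of R d @^-1` ball (rq q.1.1) q.2.+1%:R^-1) `*`
   (@rv_of R d @^-1` ball (rq q.1.2) q.2.+1%:R^-1)); last first.
  by apply/seteqP; split=> [z []|z []].
by apply: measurableX; exact: measurable_preimage_rv_ball.
Qed.

Lemma measurable_continuous_kernel (k : pt R d -> pt R d -> R) :
  continuous (fun p : 'rV[R]_d * 'rV[R]_d => k (pt_of p.1) (pt_of p.2)) ->
  measurable_fun setT (fun z : pt R d * pt R d => k z.1 z.2).
Proof.
set g := fun p => _ => cg.
have gE : (fun z : pt R d * pt R d => k z.1 z.2) = g \o rv2.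
  by apply/funext => z; rewrite /g /= !pt_of_rv.
rewrite gE => mD; apply: (measurability _ (RGenOInfty.measurableE R)) => //.
move=> _ [_ [y ->] <-]; rewrite setTI comp_preimage.
apply: measurable_preimage_rv_open; exact: (continuousP _).1.
Qed.

End ContinuousMeasurable.

(** * Mean embeddings, their inner product and the RKHS *)

Section MeanEmbedding.
Variables (R : realType) (d : nat) (k : pt R d -> pt R d -> R).
Hypothesis mk : measurable_fun setT (fun z : pt R d * pt R d => k z.1 z.2).
Hypotheses (pdk : pd_kernel k) (k1 : forall x, k x x <= 1).
Local Notation prob := (probability (pt R d) R).
Implicit Types (P : prob) (x : pt R d) (s t : seq (prob * R)).

(** Positivity at the weights [(1, 1)] and [(1, -1)] gives [2 |k x y| <= k x x + k y y]. *)
Lemma kernel_norm_le1 x y : `|k x y| <= 1.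
Proof.
have [ks kp] := pdk.
have := kp [:: (x, 1); (y, 1)]; have := kp [:: (x, 1); (y, - 1)].
rewrite !(big_cons, big_nil)/= !addr0 (ks y x) => h1 h2.
have := k1 x; have := k1 y; rewrite ler_norml; lra.
Qed.

Lemma bmeas_k : bmeas (fun z : pt R d * pt R d => k z.1 z.2).
Proof. by split=> //; exists 1 => z; exact: kernel_norm_le1. Qed.

(** The mean embedding [mu_P] as a function. *)
Definition kmean P (x : pt R d) : R := Rintegral P setT (fun b => k x b).

Lemma bmeas_kx x : bmeas (k x).
Proof. exact: (bmeas_pair1 x bmeas_k). Qed.

Lemma bmeas_kmean P : bmeas (kmean P).
Proof.
exact: (@bmeas_kernel R _ _ _ _ (fun=> P)
  (fun U mU => @measurable_cst _ _ _ _ setT _) _ bmeas_k).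
Qed.

Lemma ktilE P P' : ktil k P P' = Rintegral P setT (kmean P').
Proof. by []. Qed.

Lemma ktilC P P' : ktil k P P' = ktil k P' P.
Proof.
rewrite /ktil (Rint_fubini P P' bmeas_k); apply: eq_Rintegral => x _.
by apply: eq_Rintegral => y _; rewrite pdk.1.
Qed.

Definition dir x : prob := \d_x.

Lemma Rint_dir x (h : pt R d -> R) : bmeas h -> Rintegral (dir x) setT h = h x.
Proof.
move=> bh; rewrite /Rintegral integral_dirac ?diracT ?mul1e//.
by apply/measurable_EFinP; exact: bh.1.
Qed.

Lemma ktil_dir x P : ktil k (dir x) P = kmean P x.
Proof. by rewrite ktilE Rint_dir//; exact: bmeas_kmean. Qed.

Lemma ktil_dir2 x y : ktil k (dir x) (dir y) = k x y.
Proof. by rewrite ktil_dir /kmean Rint_dir//; exact: bmeas_kx. Qed.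

Lemma ktil_le1 P P' : `|ktil k P P'| <= 1.
Proof.
apply: Rint_norm_le; first exact: bmeas_kmean.
move=> x; apply: Rint_norm_le; first exact: bmeas_kx.
exact: kernel_norm_le1.
Qed.

(** Inner product of two formal combinations [sum c_i mu_(P_i)]; sequences with possible repetitions
    stand for vectors, so no quotient is formed. *)
Definition kform s t : R := \sum_(p <- s) \sum_(q <- t) p.2 * q.2 * ktil k p.1 q.1.

Definition scale_comb (c : R) s := [seq (p.1, c * p.2) | p <- s].

Lemma kform_catl s s' t : kform (s ++ s') t = kform s t + kform s' t.
Proof. by rewrite /kform big_cat. Qed.

Lemma kformC s t : kform s t = kform t s.
Proof.
rewrite /kform exchange_big; apply: eq_bigr => p _; apply: eq_bigr => q _.
by rewrite ktilC (mulrC q.2).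
Qed.

Lemma kform_catr s t t' : kform s (t ++ t') = kform s t + kform s t'.
Proof. by rewrite kformC kform_catl !(kformC s). Qed.

Lemma kform_scalel c s t : kform (scale_comb c s) t = c * kform s t.
Proof.
rewrite /kform big_map mulr_sumr; apply: eq_bigr => p _.
by rewrite mulr_sumr; apply: eq_bigr => q _; rewrite /= !mulrA.
Qed.

Lemma kform_scaler c s t : kform s (scale_comb c t) = c * kform s t.
Proof. by rewrite kformC kform_scalel kformC. Qed.

Definition dircomb (g : seq (pt R d * R)) : seq (prob * R) :=
  [seq (dir p.1, p.2) | p <- g].

Lemma kform_dircomb g : kform (dircomb g) (dircomb g) = h0_sqnorm k g.
Proof.
rewrite /kform /h0_sqnorm big_map; apply: eq_bigr => p _.
by rewrite big_map; apply: eq_bigr => q _; rewrite /= ktil_dir2.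
Qed.

(* The quadratic form in which every diagonal coefficient [ktil P P] is raised
   to [1]: it is affine in each measure separately, so its sign can be checked
   on Dirac masses. *)
Let tform s := kform s s + \sum_(p <- s) p.2 ^+ 2 * (1 - ktil k p.1 p.1).

Let tform_mid p s t : tform (s ++ p :: t) =
  p.2 ^+ 2 + 2 * p.2 * (\sum_(q <- s ++ t) q.2 * ktil k p.1 q.1) + tform (s ++ t).
Proof.
have mid (F : prob * R -> R) :
    \sum_(q <- s ++ p :: t) F q = F p + \sum_(q <- s ++ t) F q.
  by rewrite !big_cat big_cons /= addrCA.
have kmid u : kform (s ++ p :: t) u = kform [:: p] u + kform (s ++ t) u.
  by rewrite {1}/kform mid /kform big_seq1.
rewrite /tform mid kmid !(kformC _ (s ++ p :: t)) !kmid (kformC (s ++ t) [:: p]).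
have -> : kform [:: p] (s ++ t) = p.2 * (\sum_(q <- s ++ t) q.2 * ktil k p.1 q.1).
  by rewrite /kform big_seq1 mulr_sumr; apply: eq_bigr => q _; rewrite mulrA.
rewrite {1}/kform !big_seq1; ring.
Qed.

(** Induction trades the measures of [s] one by one for Dirac masses. A raised diagonal contributes
    [c^2] both for [P] and for a point [x], so integrating the inequality with the Dirac mass at [x]
    against [P] yields exactly the form with [P]. *)
Let tform_ge0 s g : 0 <= tform (s ++ dircomb g).
Proof.
elim: s g => [|[P c] s ih] g.
  rewrite /= /tform kform_dircomb addr_ge0 ?pdk.2//.
  rewrite big_map sumr_ge0// => p _.
  by rewrite mulr_ge0 ?sqr_ge0//= ktil_dir2 subr_ge0.
have h x : 0 <= c ^+ 2 + 2 * c * (\sum_(q <- s ++ dircomb g) q.2 * kmean q.1 x)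
   + tform (s ++ dircomb g).
  have := ih ((x, c) :: g); rewrite /= tform_mid/=.
  by under eq_bigr do rewrite ktil_dir.
have := @tform_mid (P, c) [::] (s ++ dircomb g) => /= ->.
have -> : \sum_(q <- s ++ dircomb g) q.2 * ktil k P q.1 =
    Rintegral P setT (fun x => \sum_(q <- s ++ dircomb g) q.2 * kmean q.1 x).
  rewrite Rint_sum; last first.
    by move=> q; apply: bmeasM; [exact: bmeas_cst|exact: bmeas_kmean].
  by apply: eq_bigr => q _; rewrite RintZ//; exact: bmeas_kmean.
set G := fun x => _.
have bG : bmeas G.
  by apply: bmeas_sum => q; apply: bmeasM; [exact: bmeas_cst|exact: bmeas_kmean].
rewrite -RintZ// -[X in X + _ + _](Rint_cst P) -[X in _ + X](Rint_cst P).
have b1 := bmeasM (bmeas_cst (2 * c)) bG.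
rewrite -!RintD//; try exact: bmeas_cst; last by apply: bmeasD => //; exact: bmeas_cst.
by apply: Rintegral_ge0 => x _; exact: h.
Qed.

(** [N] copies of [s] scaled by [1 / N] represent the same vector, but their diagonal correction is
    [N] times smaller. *)
Let rep N s := flatten (nseq N (scale_comb N%:R^-1 s)).

Let big_flatten_nseq N s (F : prob * R -> R) :
  \sum_(p <- flatten (nseq N s)) F p = N%:R * \sum_(p <- s) F p.
Proof.
elim: N => [|N ih] /=; first by rewrite big_nil mul0r.
by rewrite big_cat/= ih -natr1 mulrDl mul1r addrC.
Qed.

(** [tform] of [rep N s] is [kform s s + D / N]; if [kform s s] were negative, an [N] beyond
    [D / - kform s s] would make this negative. *)
Lemma kform_ge0 s : 0 <= kform s s.
Proof.
rewrite leNgt; apply/negP => Q0.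
pose D := \sum_(p <- s) p.2 ^+ 2 * (1 - ktil k p.1 p.1).
have h N : (0 < N)%N -> 0 <= kform s s + D / N%:R.
  move=> N0; have N0' : N%:R != 0 :> R by rewrite pnatr_eq0 -lt0n.
  have := tform_ge0 (rep N s) [::]; rewrite /= cats0 /tform /rep.
  have -> : kform (flatten (nseq N (scale_comb N%:R^-1 s)))
      (flatten (nseq N (scale_comb N%:R^-1 s))) = kform s s.
    rewrite {1}/kform big_flatten_nseq.
    under eq_bigr do rewrite big_flatten_nseq.
    rewrite -mulr_sumr -/(kform _ _) kform_scalel kform_scaler.
    by field.
  rewrite big_flatten_nseq big_map/=.
  under eq_bigr do rewrite exprMn -mulrA.
  rewrite -mulr_sumr -/D; congr (_ <= _ + _); by field.
pose N := (Num.truncn (D / - kform s s)).+1.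
have := h N isT; have : D / - kform s s < N%:R by apply: truncnS_gt.
rewrite ltr_pdivrMr ?oppr_gt0// => h1 h2.
have N0 : 0 < N%:R :> R by rewrite ltr0n.
have : 0 <= (kform s s + D / N%:R) * N%:R by rewrite mulr_ge0// ltW.
rewrite mulrDl divfK ?gt_eqF//; lra.
Qed.

Lemma kform_CS s t : kform s t ^+ 2 <= kform s s * kform t t.
Proof.
apply: discr_le => c; have := kform_ge0 (s ++ scale_comb (- c) t).
rewrite kform_catl !kform_catr !(kform_scalel, kform_scaler) (kformC t s).
by congr (_ <= _); ring.
Qed.

Lemma bmeas_h0_eval g : bmeas (h0_eval k g).
Proof.
by apply: bmeas_sum => p; apply: bmeasM; [exact: bmeas_cst|exact: bmeas_kx].
Qed.

Lemma Exp_h0_eval P g : Exp P (h0_eval k g) = \sum_(p <- g) p.2 * kmean P p.1.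
Proof.
rewrite /Exp /h0_eval Rint_sum; last first.
  by move=> p; apply: bmeasM; [exact: bmeas_cst|exact: bmeas_kx].
by apply: eq_bigr => p _; rewrite RintZ//; exact: bmeas_kx.
Qed.

(** By the reproducing property the pairing is [kform] of [s] with [g] read as a combination of
    Dirac masses. *)
Lemma h0_pairing_CS g s :
  (\sum_(p <- s) p.2 * Exp p.1 (h0_eval k g)) ^+ 2 <= h0_sqnorm k g * kform s s.
Proof.
have -> : \sum_(p <- s) p.2 * Exp p.1 (h0_eval k g) = kform (dircomb g) s.
  rewrite kformC /kform; apply: eq_bigr => p _.
  rewrite Exp_h0_eval mulr_sumr big_map; apply: eq_bigr => q _ /=.
  by rewrite ktilC ktil_dir mulrA.
by rewrite -kform_dircomb kform_CS.
Qed.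

Variables (f : pt R d -> R) (B : R).
Hypothesis fB : rkhs_norm_le k f B.

(** The uniform bound comes from [|g x| <= B sqrt (k x x)] and is the majorant for passing to the
    limit under integrals. *)
Lemma rkhs_approx : exists g : nat -> seq (pt R d * R),
  [/\ forall m, h0_sqnorm k (g m) <= B ^+ 2,
      forall m x, `|h0_eval k (g m) x| <= B &
      forall x, (fun m => h0_eval k (g m) x) @ \oo --> f x].
Proof.
have [B0 [g [gB [_ gf]]]] := fB; exists g; split=> // m x.
have := h0_pairing_CS (g m) [:: (dir x, 1)].
rewrite big_seq1 /= mul1r /Exp Rint_dir; last exact: bmeas_h0_eval.
rewrite /kform !big_seq1 /= ktil_dir2 !mul1r => h.
rewrite -ler_sqr ?nnegrE// real_normK ?num_real//.
apply: le_trans h _; apply: le_trans (gB m); rewrite ler_piMr//.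
exact: pdk.2.
Qed.

Lemma rkhs_bmeas : bmeas f.
Proof.
have [g [_ gB gf]] := rkhs_approx; split.
  apply: (@measurable_fun_cvg _ _ _ setT (fun m => h0_eval k (g m)) f) => //.
  by move=> m; exact: (bmeas_h0_eval (g m)).1.
exists B => x; apply: (ler_cvg_to (cvg_norm (gf x)) (@cvg_cst _ B _ _ _)).
by near=> m; exact: gB.
Unshelve. all: by end_near. Qed.

(** Cauchy-Schwarz for [<f, sum c_i mu_(P_i)>], obtained from the pre-RKHS by dominated
    convergence. *)
Lemma rkhs_pairing_CS s :
  (\sum_(p <- s) p.2 * Exp p.1 f) ^+ 2 <= B ^+ 2 * kform s s.
Proof.
have [g [gB gn gf]] := rkhs_approx.
have cE P : (fun m => Exp P (h0_eval k (g m))) @ \oo --> Exp P f.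
  by apply: (Rint_cvg _ (M := B)) => // m; exact: (bmeas_h0_eval (g m)).1.
have cS : (fun m => \sum_(p <- s) p.2 * Exp p.1 (h0_eval k (g m))) @ \oo -->
    \sum_(p <- s) p.2 * Exp p.1 f.
  elim: s => [|p s ih].
    by under eq_cvg do rewrite big_nil; rewrite big_nil; exact: cvg_cst.
  under eq_cvg do rewrite big_cons; rewrite big_cons.
  by apply: cvgD => //; apply: cvgMr; exact: cE.
have cS2 : (fun m => (\sum_(p <- s) p.2 * Exp p.1 (h0_eval k (g m))) ^+ 2) @ \oo -->
    (\sum_(p <- s) p.2 * Exp p.1 f) ^+ 2 by exact: (cvgM cS cS).
apply: (ler_cvg_to cS2 (@cvg_cst _ (B ^+ 2 * kform s s) _ _ _)).
near=> m; apply: le_trans (h0_pairing_CS (g m) s) _.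
by rewrite ler_wpM2r ?kform_ge0.
Unshelve. all: by end_near. Qed.

Section Gram.
Variables (m : nat) (Ps : 'I_m -> prob).

Definition comb (v : 'rV[R]_m) : seq (prob * R) :=
  [seq (Ps i, v ord0 i) | i <- enum 'I_m].

Let big_comb (F : prob * R -> R) (v : 'rV[R]_m) :
  \sum_(p <- comb v) F p = \sum_i F (Ps i, v ord0 i).
Proof. by rewrite /comb big_map big_enum. Qed.

Lemma kform_comb (v w : 'rV[R]_m) :
  kform (comb v) (comb w) = dotmx (v *m gram k Ps) w.
Proof.
rewrite dotmxE /kform big_map big_enum /=.
under [RHS]eq_bigr do rewrite mxE mulr_suml.
rewrite [RHS]exchange_big; apply: eq_bigr => i _.
rewrite big_map big_enum; apply: eq_bigr => j _ /=; rewrite mxE; ring.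
Qed.

Lemma gram_sym : (gram k Ps)^T = gram k Ps.
Proof. by apply/matrixP => i j; rewrite !mxE ktilC. Qed.

Lemma gram_psd (v : 'rV[R]_m) : 0 <= dotmx (v *m gram k Ps) v.
Proof. by rewrite -kform_comb kform_ge0. Qed.

Lemma kvec_dot (v : 'rV[R]_m) P : dotmx v (kvec k Ps P) = kform [:: (P, 1)] (comb v).
Proof.
rewrite dotmxE /kform big_seq1 big_map big_enum; apply: eq_bigr => i _ /=.
by rewrite mxE mul1r.
Qed.

(** The vector [mu_P - sum v_i mu_(P_i)]. *)
Let residual P (v : 'rV[R]_m) := (P, 1) :: scale_comb (- 1) (comb v).

Lemma residualE P (v : 'rV[R]_m) : kform (residual P v) (residual P v) =
  ktil k P P - 2 * dotmx v (kvec k Ps P) + dotmx (v *m gram k Ps) v.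
Proof.
rewrite /residual -cat1s kform_catl !kform_catr !(kform_scalel, kform_scaler).
rewrite (kformC (comb v) [:: _]) -kvec_dot kform_comb.
rewrite /kform !big_seq1 /=; ring.
Qed.

Lemma gram_bordered_psd P (v : 'rV[R]_m) :
  0 <= ktil k P P - 2 * dotmx v (kvec k Ps P) + dotmx (v *m gram k Ps) v.
Proof. by rewrite -residualE kform_ge0. Qed.

(** Supplies the hypothesis of [ridge_bias]. *)
Lemma rkhs_residual P (v : 'rV[R]_m) :
  (Exp P f - dotmx v (\row_i Exp (Ps i) f)) ^+ 2 <= B ^+ 2 *
  (ktil k P P - 2 * dotmx v (kvec k Ps P) + dotmx (v *m gram k Ps) v).
Proof.
rewrite -residualE; have := rkhs_pairing_CS (residual P v).
rewrite /residual big_cons big_map big_comb /=.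
suff -> : 1 * Exp P f + \sum_i -1 * v ord0 i * Exp (Ps i) f =
    Exp P f - dotmx v (\row_i Exp (Ps i) f) by [].
rewrite mul1r dotmxE -sumrN; congr (_ + _); apply: eq_bigr => i _.
by rewrite mxE mulN1r mulNr.
Qed.

End Gram.

End MeanEmbedding.

(** * From events to functions: domination by a mixture of laws *)

Section Mixture.
Context {R : realType} {dO dT : measure_display}
  {Om : measurableType dO} {T : measurableType dT}.
Variable mu : {measure set Om -> \bar R}.
Variables (phi : Om -> T) (D : Om -> R) (W : Om -> \bar R).
Variable kap : Om -> {measure set T -> \bar R}.
Hypotheses (mphi : measurable_fun setT phi) (mD : measurable_fun setT D)
  (mW : measurable_fun setT W) (D0 : forall w, 0 <= D w)
  (W0 : forall w, (0 <= W w)%E)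
  (mkap : forall U, measurable U -> measurable_fun setT (fun w => kap w U)).
(** Weighted by [D], the law of [phi] is at most the mixture of the laws [kap w] with weights
    [W w]. *)
Hypothesis setle : forall C, measurable C ->
  (\int[mu]_w (D w * \1_C (phi w))%:E <= \int[mu]_w (kap w C * W w))%E.

Import HBNNSimple.

Let simple_le (h : {nnsfun T >-> R}) :
  (\int[mu]_w (D w * h (phi w))%:E <= \int[mu]_w ((\int[kap w]_z (h z)%:E) * W w))%E.
Proof.
have fin : finite_set (range h) by exact: fimfunP.
have mI r : measurable (h @^-1` [set r]) by [].
have r_ge0 (r : R) : range h r -> 0 <= r by move=> [z _ <-].
have eL : (\int[mu]_w (D w * h (phi w))%:E =
    \sum_(r \in range h) (r%:E * \int[mu]_w (D w * \1_(h @^-1` [set r]) (phi w))%:E))%E.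
  under eq_integral => w _.
    rewrite fimfunE EFinM -fsumEFin// ge0_mule_fsumr; last first.
      by move=> r; rewrite EFinM nnfun_muleindic_ge0.
    over.
  rewrite ge0_integral_fsum//; last 2 first.
  - move=> r; apply/measurable_EFinP; apply: measurable_funM => //.
    by apply: measurable_funM => //; exact: measurableT_comp.
  - move=> r w _; rewrite mule_ge0 ?lee_fin//.
    by have := nnfun_muleindic_ge0 h r (phi w); rewrite -EFinM lee_fin.
  apply: eq_fsbigr => r /[!inE] rh.
  rewrite -ge0_integralZl_EFin//; last 3 first.
  - by move=> w _; rewrite lee_fin mulr_ge0.
  - apply/measurable_EFinP; apply: measurable_funM => //.
    exact: measurableT_comp.
  - exact: r_ge0.
  by apply: eq_integral => w _; rewrite -!EFinM mulrCA.
have eR : (\int[mu]_w ((\int[kap w]_z (h z)%:E) * W w) =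
    \sum_(r \in range h) (r%:E * \int[mu]_w (kap w (h @^-1` [set r]) * W w)))%E.
  under eq_integral => w _.
    rewrite integralT_nnsfun sintegralE muleC ge0_mule_fsumr; last first.
      by move=> r; exact: nnsfun_mulemu_ge0.
    over.
  rewrite ge0_integral_fsum//; last 2 first.
  - move=> r; apply: emeasurable_funM => //; apply: emeasurable_funM => //.
    exact: mkap.
  - by move=> r w _; rewrite mule_ge0// nnsfun_mulemu_ge0.
  apply: eq_fsbigr => r /[!inE] rh.
  rewrite -ge0_integralZl_EFin//; last 3 first.
  - by move=> w _; rewrite mule_ge0.
  - by apply: emeasurable_funM => //; exact: mkap.
  - exact: r_ge0.
  by apply: eq_integral => w _; rewrite muleC muleA.
rewrite eL eR; apply: lee_fsum => // r rh.
by rewrite lee_wpmul2l ?lee_fin ?r_ge0//; exact: setle.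
Qed.

(** Splitting over level sets settles simple functions. On the left monotone convergence passes to
    the limit; on the right the approximants stay below [g]. *)
Lemma mixture_le (g : T -> R) : measurable_fun setT g -> (forall z, 0 <= g z) ->
  (\int[mu]_w (D w * g (phi w))%:E <= \int[mu]_w ((\int[kap w]_z (g z)%:E) * W w))%E.
Proof.
move=> mg g0.
have mg' : measurable_fun setT (EFin \o g) by exact/measurable_EFinP.
have g0' z : setT z -> (0 <= (EFin \o g) z)%E by rewrite lee_fin.
pose h := nnsfun_approx measurableT mg'.
pose F n w := (D w * h n (phi w))%:E.
have hcvg z : (fun n => (h n z)%:E) @ \oo --> (g z)%:E.
  exact: (cvg_nnsfun_approx measurableT mg' g0').
have nd z n m : (n <= m)%N -> h n z <= h m z.
  by move=> nm; exact/lefP/nd_nnsfun_approx.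
have mF n : measurable_fun setT (F n).
  apply/measurable_EFinP; apply: measurable_funM => //; exact: measurableT_comp.
have F0 n w : setT w -> (0 <= F n w)%E by rewrite lee_fin mulr_ge0.
have ndF w : setT w -> {homo F ^~ w : n m / (n <= m)%N >-> (n <= m)%E}.
  by move=> _ n m nm; rewrite lee_fin ler_wpM2l// nd.
have := cvg_monotone_convergence (mu := mu) measurableT mF F0 ndF.
have -> : (\int[mu]_w limn (F ^~ w) = \int[mu]_w (D w * g (phi w))%:E)%E.
  apply: eq_integral => w _; apply/cvg_lim => //; rewrite EFinM.
  exact: (@cvgeZl _ _ _ (fun n => (h n (phi w))%:E) _ (D w)%:E isT (hcvg (phi w))).
move=> cv; rewrite -(cvg_lim _ cv)//; apply: lime_le.
  by apply/cvg_ex; eexists; exact: cv.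
near=> n; apply: le_trans (simple_le (h n)) _.
have mker (k : T -> R) : measurable_fun setT k -> (forall z, 0 <= k z) ->
    measurable_fun setT (fun w => \int[kap w]_z (k z)%:E)%E.
  move=> mk k0; apply: measurable_fun_integral_kernel => //.
  exact/measurable_EFinP.
apply: ge0_le_integral => //.
- by move=> w _; rewrite mule_ge0// integral_ge0// => z _; rewrite lee_fin.
- by apply: emeasurable_funM => //; exact: mker.
- by apply: emeasurable_funM => //; exact: mker.
- move=> w _; rewrite lee_wpmul2r//; apply: ge0_le_integral => //.
  + by move=> z _; rewrite lee_fin.
  + exact/measurable_EFinP.
  + by move=> z _; rewrite /h nnsfun_approxE; exact: (le_approx n g0').
Unshelve. all: by end_near. Qed.

End Mixture.

(** * Sub-sigma-algebras as types *)

Section SubSigmaAlgebra.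
Context {R : realType} {dO : measure_display} {Om : measurableType dO}.
Variable mu : {measure set Om -> \bar R}.
Variable F : set (set Om).
Hypotheses (sF : sigma_algebra setT F) (Fm : F `<=` measurable).

(** Retyping [Om] with [F] as its sigma-algebra turns [F]-measurability into [measurable_fun], with
    its closure properties. *)
Definition sub_sigma := g_sigma_algebraType F.

Lemma sub_sigmaE (A : set Om) : @measurable _ sub_sigma A = F A.
Proof.
have h := sigma_algebra_id sF.
by change (<<s F>> A = F A); rewrite h.
Qed.

Lemma G_measP d (T : measurableType d) (g : Om -> T) :
  G_meas F g <-> measurable_fun setT (g : sub_sigma -> T).
Proof.
split=> h.
  by move=> _ B mB; rewrite setTI sub_sigmaE; exact: h.
move=> B mB; have := h measurableT B mB.
by rewrite setTI sub_sigmaE.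
Qed.

Lemma measurable_sub_sigma d (T : measurableType d) (g : Om -> T) :
  measurable_fun setT (g : sub_sigma -> T) -> measurable_fun setT g.
Proof. by move=> /G_measP h _ B mB; rewrite setTI; exact/Fm/h. Qed.

(** An inequality tested on the events of [F] extends to [F]-measurable weights: this is
    [mixture_le] for the identity map into [sub_sigma] with Dirac kernels. *)
Lemma sub_sigma_le (X Y : Om -> R) (Z : sub_sigma -> R) :
  measurable_fun setT X -> measurable_fun setT Y ->
  measurable_fun setT Z -> (forall w, 0 <= X w) -> (forall w, 0 <= Y w) ->
  (forall w, 0 <= Z w) ->
  (forall E, F E -> (\int[mu]_w (X w * \1_E w)%:E <= \int[mu]_w (Y w * \1_E w)%:E)%E) ->
  (\int[mu]_w (X w * Z w)%:E <= \int[mu]_w (Y w * Z w)%:E)%E.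
Proof.
move=> mX mY mZ X0 Y0 Z0 h.
have mid : measurable_fun setT (id : Om -> sub_sigma).
  by move=> _ B; rewrite setTI sub_sigmaE; exact: Fm.
have := @mixture_le R _ _ Om sub_sigma mu id X (EFin \o Y)
  (fun w => (\d_(w : sub_sigma))%R) mid mX _ X0 _ _ _ Z mZ Z0.
have -> : (\int[mu]_w ((\int[(\d_(w : sub_sigma))%R]_z (Z z)%:E) * (EFin \o Y) w) =
   \int[mu]_w (Y w * Z w)%:E)%E.
  apply: eq_integral => w _; rewrite integral_dirac//; last exact/measurable_EFinP.
  by rewrite diracT mul1e /= muleC.
apply.
- exact/measurable_EFinP.
- by move=> w; rewrite lee_fin.
- move=> U mU; apply: measurable_fun_dirac.
  by apply: Fm; rewrite -sub_sigmaE.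
- move=> C mC; apply: le_trans (h C _) _; first by rewrite -sub_sigmaE.
  rewrite le_eqVlt; apply/orP; left; apply/eqP.
  apply: eq_integral => w _; rewrite /= muleC diracE indicE.
  by rewrite EFinM.
Qed.

End SubSigmaAlgebra.

(** * Gaussian mixtures of exponentials *)

Section Gauss.
Variable R : realType.
Implicit Types m v e th : R.

(** Normal density of mean [m] and variance [v], written as one exponential so that products reduce
    to identities between exponents. *)
Definition gaussd m v th : R :=
  expR (- (ln (v * pi *+ 2) / 2) - (th - m) ^+ 2 / (2 * v)).

Lemma gaussd_normal m v : 0 < v -> gaussd m v = normal_pdf m (Num.sqrt v).
Proof.
move=> v0; have s0 : Num.sqrt v != 0 by rewrite gt_eqF// sqrtr_gt0.
have p0 : 0 < v * pi *+ 2 by rewrite mulrn_wgt0// mulr_gt0// pi_gt0.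
rewrite normal_pdfE//; apply/funext => th; rewrite /gaussd expRD; congr (_ * _).
  rewrite /normal_peak sqr_sqrtr ?(ltW v0)// expRN; congr (_^-1).
  by rewrite -powR12_sqrt ?(ltW p0)// /powR gt_eqF// mulrC.
rewrite /normal_fun sqr_sqrtr ?(ltW v0)//; congr expR.
by rewrite mulNr -(mulr_natl v).
Qed.

Lemma integral_gaussd m v : 0 < v ->
  (\int[lebesgue_measure]_th (gaussd m v th)%:E = 1)%E.
Proof. by move=> v0; rewrite gaussd_normal// integral_normal_pdf. Qed.

(** Completing the square in [th]: the precision rises from [1 / v] to [1 + 1 / v]. *)
Lemma gaussd_mixture m v e th : 0 < v ->
  expR (th * e - th ^+ 2 / 2) * gaussd m v th =
  expR ((e ^+ 2 - (e - m) ^+ 2 / (1 + v)) / 2 - ln (1 + v) / 2) *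
    gaussd ((v * e + m) / (1 + v)) (v / (1 + v)) th.
Proof.
move=> v0; rewrite /gaussd -!expRD; congr expR.
have v1 : 0 < 1 + v by rewrite addr_gt0.
have p0 : 0 < v / (1 + v) * pi *+ 2.
  by rewrite mulrn_wgt0// mulr_gt0 ?pi_gt0// divr_gt0.
have -> : ln (v * pi *+ 2) = ln (1 + v) + ln (v / (1 + v) * pi *+ 2).
  rewrite -lnM ?posrE//; congr ln; field; exact: lt0r_neq0.
by field; rewrite !gt_eqF.
Qed.

Lemma gaussd_mixture_integral m v e : 0 < v ->
  (\int[lebesgue_measure]_th (expR (th * e - th ^+ 2 / 2) * gaussd m v th)%:E =
  (expR ((e ^+ 2 - (e - m) ^+ 2 / (1 + v)) / 2 - ln (1 + v) / 2))%:E)%E.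
Proof.
move=> v0; have v1 : 0 < 1 + v by rewrite addr_gt0.
under eq_integral do rewrite gaussd_mixture// EFinM.
rewrite ge0_integralZl_EFin//.
- by rewrite integral_gaussd ?mule1// divr_gt0.
- by move=> th _; rewrite lee_fin expR_ge0.
- rewrite gaussd_normal ?divr_gt0//; apply/measurable_EFinP.
  exact: measurable_normal_pdf.
Qed.

End Gauss.

(** * One step of the mixture supermartingale *)

Section MixtureStep.
Context {R : realType} {dO : measure_display} {Om : measurableType dO}.
Variable Pr : probability Om R.
Variable F : set (set Om).
Hypotheses (sF : sigma_algebra setT F) (Fm : F `<=` measurable).
Variables (e : Om -> R) (m v Z : sub_sigma F -> R).
Hypotheses (me : measurable_fun setT e) (mm : measurable_fun setT m)
  (mv : measurable_fun setT v) (mZ : measurable_fun setT Z)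
  (v0 : forall w, 0 < v w) (Z0 : forall w, 0 <= Z w).
Hypothesis subg : forall th E, F E ->
  (\int[Pr]_w (expR (th * e w - th ^+ 2 / 2) * \1_E w)%:E <= Pr E)%E.

(* The left side is a Gaussian mixture over [th] of exponential martingale
   increments, with mean and variance known before [e] is drawn. *)
Lemma mixture_step :
  (\int[Pr]_w (Z w * expR ((e w ^+ 2 - (e w - m w) ^+ 2 / (1 + v w)) / 2 -
     ln (1 + v w) / 2))%:E <= \int[Pr]_w (Z w)%:E)%E.
Proof.
(* Copies typed on [Om] with its full sigma-algebra, on which [Pr] and the product with Lebesgue
   measure are defined. *)
pose m' : Om -> R := m; pose v' : Om -> R := v; pose Z' : Om -> R := Z.
have mm' : measurable_fun setT m' by exact: (measurable_sub_sigma sF Fm mm).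
have mv' : measurable_fun setT v' by exact: (measurable_sub_sigma sF Fm mv).
have mZ' : measurable_fun setT Z' by exact: (measurable_sub_sigma sF Fm mZ).
have mpos d (T : measurableType d) (g : T -> R) : measurable_fun setT g ->
    (forall x, 0 < g x) -> measurable_fun setT (fun x => (g x)^-1).
  move=> mg g0; rewrite [X in measurable_fun _ X](_ : _ = (fun x => expR (- ln (g x)))).
    by apply: measurableT_comp => //; apply: measurable_funN; exact: measurableT_comp.
  by apply/funext => x; rewrite expRN lnK ?posrE.
have mln d (T : measurableType d) (g : T -> R) : measurable_fun setT g ->
    measurable_fun setT (fun x => ln (g x)).
  by move=> mg; exact: measurableT_comp.
have mexp d (T : measurableType d) (g : T -> R) : measurable_fun setT g ->
    measurable_fun setT (fun x => expR (g x)).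
  by move=> mg; exact: measurableT_comp.
have mg d (T : measurableType d) (m1 v1 th1 : T -> R) : measurable_fun setT m1 ->
    measurable_fun setT v1 -> (forall x, 0 < v1 x) -> measurable_fun setT th1 ->
    measurable_fun setT (fun x => gaussd (m1 x) (v1 x) (th1 x)).
  move=> h1 h2 h3 h4; apply: mexp; apply: measurable_funB.
    apply: measurable_funN; apply: measurable_funM => //; apply: mln.
    rewrite [X in measurable_fun _ X](_ : _ = (fun x => v1 x * (pi *+ 2))).
      exact: measurable_funM.
    by apply/funext => x; rewrite -mulrnAr.
  apply: measurable_funM.
    by apply: measurable_funX; apply: measurable_funB.
  by apply: mpos => [|x]; [apply: measurable_funM|rewrite mulr_gt0].
have mE d (T : measurableType d) (e1 th1 : T -> R) : measurable_fun setT e1 ->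
    measurable_fun setT th1 ->
    measurable_fun setT (fun x => expR (th1 x * e1 x - th1 x ^+ 2 / 2)).
  move=> h1 h2; apply: mexp; apply: measurable_funB; first exact: measurable_funM.
  by apply: measurable_funM => //; apply: measurable_funX.
have g0 (a b c : R) : 0 <= gaussd a b c by exact: expR_ge0.
pose J (x : Om * R) : \bar R :=
  (Z' x.1 * (expR (x.2 * e x.1 - x.2 ^+ 2 / 2) * gaussd (m' x.1) (v' x.1) x.2))%:E.
pose J0 (x : Om * R) : \bar R := (Z' x.1 * gaussd (m' x.1) (v' x.1) x.2)%:E.
have m1 (g : Om -> R) : measurable_fun setT g ->
    measurable_fun setT (fun x : Om * R => g x.1).
  by move=> ?; exact: measurableT_comp.
have mJ : measurable_fun setT J.
  apply/measurable_EFinP; apply: measurable_funM; first exact: m1.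
  apply: measurable_funM; first by apply: mE => //; exact: m1.
  by apply: mg => //; exact: m1.
have mJ0 : measurable_fun setT J0.
  apply/measurable_EFinP; apply: measurable_funM; first exact: m1.
  by apply: mg => //; exact: m1.
have J_ge0 x : (0 <= J x)%E by rewrite lee_fin !mulr_ge0// expR_ge0.
have J0_ge0 x : (0 <= J0 x)%E by rewrite lee_fin !mulr_ge0.
have eL : (\int[Pr]_w (Z w * expR ((e w ^+ 2 - (e w - m w) ^+ 2 / (1 + v w)) / 2 -
     ln (1 + v w) / 2))%:E = \int[Pr]_w \int[lebesgue_measure]_th J (w, th))%E.
  apply: eq_integral => w _; rewrite EFinM -gaussd_mixture_integral//.
  rewrite -ge0_integralZl_EFin//.
  - by move=> th _; rewrite lee_fin mulr_ge0// expR_ge0.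
  - apply/measurable_EFinP; apply: measurable_funM; first by apply: mE.
    by apply: mg.
have eR : (\int[Pr]_w (Z w)%:E = \int[Pr]_w \int[lebesgue_measure]_th J0 (w, th))%E.
  apply: eq_integral => w _; rewrite /J0 /=.
  under eq_integral do rewrite EFinM.
  rewrite ge0_integralZl_EFin// ?integral_gaussd ?mule1//.
  - by move=> th _; rewrite lee_fin.
  - by apply/measurable_EFinP; apply: mg.
(* After Tonelli [th] is fixed, [Z w * gaussd (m w) (v w) th] is an [F]-measurable weight, and
   [subg] applies through [sub_sigma_le]. *)
rewrite eL eR (@fubini_tonelli _ _ _ _ _ Pr lebesgue_measure J)//.
rewrite (@fubini_tonelli _ _ _ _ _ Pr lebesgue_measure J0)//.
apply: ge0_le_integral => //.
- by move=> th _; apply: integral_ge0.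
- exact: (measurable_fun_fubini_tonelli_G J).
- exact: (measurable_fun_fubini_tonelli_G J0).
move=> th _.
have := @sub_sigma_le R _ Om Pr F sF Fm
   (fun w => expR (th * e w - th ^+ 2 / 2)) (fun=> 1)
   (fun w => Z w * gaussd (m w) (v w) th).
rewrite /J /J0 /=.
have -> : (\int[Pr]_w (expR (th * e w - th ^+ 2 / 2) * (Z w * gaussd (m w) (v w) th))%:E
   = \int[Pr]_x (Z' x * (expR (th * e x - th ^+ 2 / 2) * gaussd (m' x) (v' x) th))%:E)%E.
  by apply: eq_integral => w _; rewrite mulrCA.
have -> : (\int[Pr]_w (1 * (Z w * gaussd (m w) (v w) th))%:E =
  \int[Pr]_x (Z' x * gaussd (m' x) (v' x) th)%:E)%E.
  by apply: eq_integral => w _; rewrite mul1r.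
apply => //.
- by apply: mE.
- by apply: measurable_funM => //; apply: mg.
- by move=> w; rewrite mulr_ge0.
- move=> E FE; apply: le_trans (subg th FE) _.
  under eq_integral do rewrite mul1r.
  by rewrite integral_indic ?setIT//; exact: Fm.
Qed.

End MixtureStep.

(** * Conditional sub-Gaussianity of the observation noise *)

Section ConditionalSubgaussian.
Context {R : realType} {d : nat} {dO : measure_display} {Om : measurableType dO}.
Variable Pr : probability Om R.
Variable F : set (set Om).
Hypotheses (sF : sigma_algebra setT F) (Fm : F `<=` measurable).
Variables (Pq : pt R d -> probability (pt R d) R) (Q : Om -> probability R R).
Variables (xs xt : Om -> pt R d) (zeta : Om -> R) (f : pt R d -> R).
Variables (sq sz : R).
Hypothesis mPq : forall A, measurable A -> measurable_fun setT (fun x => Pq x A : \bar R).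
Hypotheses (mxs : measurable_fun setT (xs : sub_sigma F -> pt R d))
  (mxt : measurable_fun setT xt) (mzeta : measurable_fun setT zeta).
Hypothesis mQ : forall A, measurable A -> G_meas F (fun w => Q w A : \bar R).
Hypothesis bf : bmeas f.
Hypothesis subP : forall w l,
  (\int[Pq (xs w)]_z (expR (l * (f z - Exp (Pq (xs w)) f)))%:E <=
   (expR (l ^+ 2 * sq ^+ 2 / 2))%:E)%E.
Hypothesis subQ : forall w, subgauss_law (Q w) sz.
Hypothesis joint : forall E, F E -> forall A A', measurable A -> measurable A' ->
  Pr (E `&` xt @^-1` A `&` zeta @^-1` A')
    = (\int[Pr]_(w in E) (Pq (xs w) A * Q w A'))%E.

Let a w := Exp (Pq (xs w)) f.

Lemma measurable_Exp : measurable_fun setT (fun x => Exp (Pq x) f).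
Proof.
have bf' : bmeas (fun z : pt R d * pt R d => f z.2).
  by split; [exact: measurableT_comp bf.1 _|case: bf.2 => M h; exists M].
exact: (bmeas_kernel mPq bf').1.
Qed.

Let ma : measurable_fun setT (a : sub_sigma F -> R).
Proof. exact: measurableT_comp measurable_Exp mxs. Qed.

Let mxs' : measurable_fun setT xs.
Proof. exact: (measurable_sub_sigma sF Fm mxs). Qed.

Section Round.
Variables (l : R) (E : set Om).
Hypothesis FE : F E.
Let g x := expR (l * f x).
Let h z := expR (l * z).

Let mE : measurable E. Proof. exact: Fm. Qed.

Let mg : measurable_fun setT g.
Proof. by apply: measurableT_comp => //; apply: measurable_funM => //; exact: bf.1. Qed.

Let mh : measurable_fun setT h.
Proof. by apply: measurableT_comp => //; exact: measurable_funM. Qed.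

Let Ig w := (\int[Pq (xs w)]_z (g z)%:E)%E.

Let mIg : measurable_fun setT Ig.
Proof.
have := @measurable_fun_integral_kernel _ _ (pt R d) (pt R d) R Pq mPq (EFin \o g).
move=> /(_ _ _) H; apply: (measurableT_comp (H _ _) mxs').
  by move=> z; rewrite lee_fin expR_ge0.
exact/measurable_EFinP.
Qed.

Let mQ' A : measurable A -> measurable_fun setT (fun w => Q w A : \bar R).
Proof.
by move=> mA; apply: (measurable_sub_sigma sF Fm); apply/G_measP => //; exact: mQ.
Qed.

(** Integrates out the executed location while the event on [zeta] and its factor [Q w A'] are
    carried along; [joint] is the case of an indicator. *)
Let stepP A' : measurable A' ->
  (\int[Pr]_w (\1_(E `&` zeta @^-1` A') w * g (xt w))%:E <=
   \int[Pr]_w (Ig w * (Q w A' * (\1_E w)%:E)))%E.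
Proof.
move=> mA'.
have mzA : measurable (zeta @^-1` A') by rewrite -[X in measurable X]setTI; exact: mzeta.
apply: (@mixture_le R _ _ Om (pt R d) Pr xt _ _ (fun w => Pq (xs w))) => //.
- by apply: measurable_indic; exact: measurableI.
- apply: emeasurable_funM; first exact: mQ'.
  by apply/measurable_EFinP; exact: measurable_indic.
- by move=> w; rewrite mule_ge0.
- by move=> U mU; exact: measurableT_comp (mPq mU) mxs'.
- move=> C mC.
  have mxC : measurable (xt @^-1` C) by rewrite -[X in measurable X]setTI; exact: mxt.
  have -> : (\int[Pr]_w (\1_(E `&` zeta @^-1` A') w * \1_C (xt w))%:E =
      \int[Pr]_w (\1_(E `&` xt @^-1` C `&` zeta @^-1` A') w)%:E)%E.
    apply: eq_integral => w _; rewrite !indicI /=; congr EFin.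
    by rewrite mulrAC.
  rewrite integral_indic ?setIT//; last by do 2 apply: measurableI => //.
  rewrite [leLHS](joint FE mC mA') [leLHS]integral_mkcond le_eqVlt; apply/orP; left; apply/eqP.
  by apply: eq_integral => w _; rewrite epatch_indic muleA.
- by move=> z; exact: expR_ge0.
Qed.

(** Integrates out [zeta], with [stepP] as the inequality on events. *)
Let stepQ : (\int[Pr]_w (\1_E w * g (xt w) * h (zeta w))%:E <=
  \int[Pr]_w ((\int[Q w]_z (h z)%:E) * (Ig w * (\1_E w)%:E)))%E.
Proof.
apply: (@mixture_le R _ _ Om _ Pr zeta) => //.
- apply: measurable_funM; first exact: measurable_indic.
  exact: measurableT_comp.
- apply: emeasurable_funM => //.
  by apply/measurable_EFinP; exact: measurable_indic.
- by move=> w; rewrite mulr_ge0// expR_ge0.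
- move=> w; rewrite mule_ge0 ?lee_fin//.
  by apply: integral_ge0 => z _; rewrite lee_fin expR_ge0.
- move=> C mC; have := stepP mC; congr (_ <= _)%E.
    by apply: eq_integral => w _; rewrite indicI/= mulrAC.
  by apply: eq_integral => w _; rewrite muleCA.
- by move=> z; exact: expR_ge0.
Qed.

Lemma cond_mgf : (\int[Pr]_w (expR (l * f (xt w)) * expR (l * zeta w) * \1_E w)%:E <=
  \int[Pr]_w (expR (l * a w + l ^+ 2 * (sq ^+ 2 + sz ^+ 2) / 2) * \1_E w)%:E)%E.
Proof.
have -> : (\int[Pr]_w (expR (l * f (xt w)) * expR (l * zeta w) * \1_E w)%:E =
   \int[Pr]_w (\1_E w * g (xt w) * h (zeta w))%:E)%E.
  by apply: eq_integral => w _; congr EFin; rewrite mulrC mulrA.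
apply: le_trans stepQ _.
have mIh : measurable_fun setT (fun w => \int[Q w]_z (h z)%:E)%E.
  apply: measurable_fun_integral_kernel => //.
    by move=> z; rewrite lee_fin expR_ge0.
  exact/measurable_EFinP.
have Ih0 w : (0 <= \int[Q w]_z (h z)%:E)%E.
  by apply: integral_ge0 => z _; rewrite lee_fin expR_ge0.
have Ig0 w : (0 <= Ig w)%E.
  by apply: integral_ge0 => z _; rewrite lee_fin expR_ge0.
have ma' : measurable_fun setT a by exact: (measurable_sub_sigma sF Fm ma).
apply: ge0_le_integral => //.
- by move=> w _; rewrite !mule_ge0// lee_fin.
- apply: emeasurable_funM => //; apply: emeasurable_funM => //.
  by apply/measurable_EFinP; exact: measurable_indic.
- apply/measurable_EFinP; apply: measurable_funM; last exact: measurable_indic.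
  apply: measurableT_comp => //; apply: measurable_funD => //.
  exact: measurable_funM.
move=> w _; rewrite EFinM muleA; apply: lee_wpmul2r; first by rewrite lee_fin.
have IgE : (Ig w <= (expR (l * a w + l ^+ 2 * sq ^+ 2 / 2))%:E)%E.
  (* Splitting off the mean [a w] leaves the centred moment generating function bounded by
     [subP]. *)
  have -> : Ig w = ((expR (l * a w))%:E *
      \int[Pq (xs w)]_z (expR (l * (f z - a w)))%:E)%E.
    rewrite -ge0_integralZl_EFin ?expR_ge0//.
    - apply: eq_integral => z _; rewrite -EFinM -expRD /g; congr (expR _)%:E; ring.
    - apply/measurable_EFinP; apply: measurableT_comp => //.
      apply: measurable_funM => //; apply: measurable_funB => //; exact: bf.1.
  rewrite expRD EFinM; apply: lee_wpmul2l; first by rewrite lee_fin expR_ge0.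
  exact: subP.
apply: le_trans (lee_pmul (Ih0 w) (Ig0 w) (subQ w l) IgE) _.
rewrite -EFinM -expRD lee_fin le_eqVlt; apply/orP; left; apply/eqP; congr expR; ring.
Qed.
End Round.

Variable sn : R.
Hypotheses (sn0 : 0 < sn) (snE : sn ^+ 2 = sq ^+ 2 + sz ^+ 2).

(** At [l = th / sn], the bound of [cond_mgf] is multiplied by the inverse of its right side, an
    [F]-measurable weight. *)
Lemma cond_subgauss th E : F E ->
  (\int[Pr]_w (expR (th * ((f (xt w) + zeta w - a w) / sn) - th ^+ 2 / 2) * \1_E w)%:E
    <= Pr E)%E.
Proof.
move=> FE; pose l := th / sn.
have mE : measurable E by exact: Fm.
have := @sub_sigma_le R _ Om Pr F sF Fm
  (fun w => expR (l * f (xt w)) * expR (l * zeta w))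
  (fun w => expR (l * a w + l ^+ 2 * (sq ^+ 2 + sz ^+ 2) / 2))
  (fun w => \1_E w * expR (- (l * a w + l ^+ 2 * (sq ^+ 2 + sz ^+ 2) / 2))).
have -> : (\int[Pr]_w (expR (th * ((f (xt w) + zeta w - a w) / sn) - th ^+ 2 / 2) * \1_E w)%:E
  = \int[Pr]_w (expR (l * f (xt w)) * expR (l * zeta w) *
    (\1_E w * expR (- (l * a w + l ^+ 2 * (sq ^+ 2 + sz ^+ 2) / 2))))%:E)%E.
  apply: eq_integral => w _; congr EFin; rewrite (mulrC (\1_E w)) [RHS]mulrA -!expRD.
  congr (expR _ * _); rewrite -snE /l; field; exact: lt0r_neq0.
have -> : (\int[Pr]_w (expR (l * a w + l ^+ 2 * (sq ^+ 2 + sz ^+ 2) / 2) *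
    (\1_E w * expR (- (l * a w + l ^+ 2 * (sq ^+ 2 + sz ^+ 2) / 2))))%:E)%E = Pr E.
  rewrite -[X in Pr X]setIT -integral_indic//; apply: eq_integral => w _; congr EFin.
  by rewrite mulrCA expRxMexpNx_1 mulr1.
have ma' : measurable_fun setT a by exact: (measurable_sub_sigma sF Fm ma).
apply.
- by apply: measurable_funM; apply: measurableT_comp => //; apply: measurable_funM => //;
    exact: measurableT_comp bf.1 mxt.
- by apply: measurableT_comp => //; apply: measurable_funD => //; exact: measurable_funM.
- apply: measurable_funM; first by apply: measurable_indic; rewrite sub_sigmaE.
  apply: measurableT_comp => //; apply: measurable_funN; apply: measurable_funD => //.
  exact: measurable_funM.
- by move=> w; rewrite mulr_ge0 ?expR_ge0.
- by move=> w; exact: expR_ge0.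
- by move=> w; rewrite mulr_ge0 ?expR_ge0.
- by move=> E' FE'; exact: cond_mgf.
Qed.

End ConditionalSubgaussian.

(** * Ville's maximal inequality *)

Section Ville.
Context {R : realType} {dO : measure_display} {Om : measurableType dO}.
Variable Pr : probability Om R.
Variables (F : nat -> set (set Om)) (M : nat -> Om -> R) (n : nat) (delta : R).
Hypotheses (sF : forall t, sigma_algebra setT (F t)) (Fm : forall t, F t `<=` measurable)
  (Fmon : forall t, F t `<=` F t.+1).
Hypotheses (M0 : forall w, M 0 w = 1) (M_ge0 : forall t w, 0 <= M t w).
Hypothesis mM : forall t, (t <= n)%N -> measurable_fun setT (M t : sub_sigma (F t) -> R).
Hypothesis step : forall t E, (t < n)%N -> F t E ->
  (\int[Pr]_w (\1_E w * M t.+1 w)%:E <= \int[Pr]_w (\1_E w * M t w)%:E)%E.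
Hypothesis d01 : 0 < delta < 1.

Let U t := [set w | forall s, (s <= t)%N -> M s w < delta^-1].

Let US t : U t.+1 = U t `&` [set w | M t.+1 w < delta^-1].
Proof.
apply/seteqP; split=> w.
  by move=> h; split; [move=> s st; apply: h; exact: leqW|exact: h].
move=> [h1 h2] s; rewrite leq_eqVlt => /predU1P[->//|]; exact: h1.
Qed.

Let U0 : U 0 = setT.
Proof.
apply/seteqP; split=> // w _ s; rewrite leqn0 => /eqP ->; rewrite M0.
by rewrite invf_gt1; case/andP: d01.
Qed.

Let mlt t : (t <= n)%N -> F t [set w | M t w < delta^-1].
Proof.
move=> tn; have := mM tn measurableT (measurable_itv `]-oo, delta^-1[).
rewrite setTI sub_sigmaE//; congr (F t _).
Qed.

Let FU t : (t <= n)%N -> F t (U t).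
Proof.
elim: t => [_|t ih tn]; first by rewrite U0 -sub_sigmaE.
rewrite US -sub_sigmaE//; apply: measurableI; rewrite sub_sigmaE//.
  by apply: Fmon; apply: ih; exact: ltnW.
exact: mlt.
Qed.

Let mM' t : (t <= n)%N -> measurable_fun setT (M t).
Proof. by move=> tn; exact: (measurable_sub_sigma (sF t) (Fm (t:=t)) (mM tn)). Qed.

(** Invariant of the stopped process: paths that have crossed count [1 / delta], the others [M t].
    Since [U t] lies in [F t], [step] applies on it. *)
Let inv t : (t <= n)%N ->
  ((delta^-1)%:E * Pr (~` U t) + \int[Pr]_w (\1_(U t) w * M t w)%:E <= 1)%E.
Proof.
have d0 : 0 <= delta^-1 by rewrite invr_ge0; case/andP: d01 => /ltW.
elim: t => [_|t ih tn].
  rewrite U0 setCT measure0 mule0 add0e.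
  under eq_integral do rewrite indicT mul1r M0.
  by rewrite integral_cst// mul1e; exact: probability_le1.
have tn' : (t <= n)%N by exact: ltnW.
have mU s : (s <= n)%N -> measurable (U s) by move=> sn; apply: Fm; exact: FU.
have mUt := mU t tn'; have mUS := mU t.+1 tn.
apply: le_trans (ih tn').
have mDU : measurable (U t `\` U t.+1) by exact: measurableD.
have -> : ~` U t.+1 = ~` U t `|` (U t `\` U t.+1).
  apply/seteqP; split=> w.
    by move=> h; have [Uw|] := pselect (U t w); [right|left].
  case=> [h|[]//] Uw; apply: h; move: Uw; rewrite US => -[]//.
rewrite measureU//; [|exact: measurableC|]; last first.
  by apply/seteqP; split=> // w [h [/h]].
rewrite muleDr// ?ge0_adde_def ?inE ?measure_ge0//; last first.
rewrite -addeA leeD2l//; apply: le_trans (step tn (FU tn')).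
have -> : ((delta^-1)%:E * Pr (U t `\` U t.+1) =
    \int[Pr]_w (\1_(U t `\` U t.+1) w * delta^-1)%:E)%E.
  under eq_integral do rewrite mulrC EFinM.
  rewrite ge0_integralZl_EFin//.
  - by rewrite integral_indic// setIT.
  - by apply/measurable_EFinP; exact: measurable_indic.
rewrite -ge0_integralD//; last 4 first.
- by move=> w _; rewrite lee_fin mulr_ge0.
- by apply/measurable_EFinP; apply: measurable_funM => //; exact: measurable_indic.
- by move=> w _; rewrite lee_fin mulr_ge0.
- apply/measurable_EFinP; apply: measurable_funM; first exact: measurable_indic.
  exact: mM'.
apply: ge0_le_integral => //.
- by move=> w _; rewrite adde_ge0// lee_fin mulr_ge0.
- apply: emeasurable_funD; apply/measurable_EFinP.
    by apply: measurable_funM => //; exact: measurable_indic.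
  apply: measurable_funM; first exact: measurable_indic.
  exact: mM'.
- apply/measurable_EFinP; apply: measurable_funM; first exact: measurable_indic.
  exact: mM'.
(* Pointwise, a path leaving [U t] at time [t + 1] has [M t.+1 w >= 1 / delta]. *)
move=> w _; rewrite -EFinD lee_fin.
have [Uw|Uw] := pselect (U t w); last first.
  have NS : ~ U t.+1 w by rewrite US => -[].
  have ND : ~ (U t `\` U t.+1) w by move=> [].
  by rewrite !indicE (memNset ND) (memNset NS) (memNset Uw) !mul0r addr0.
rewrite !indicE (mem_set Uw) mul1r.
have [Mw|Mw] := ltP (M t.+1 w) delta^-1.
  have US' : U t.+1 w by rewrite US.
  have ND : ~ (U t `\` U t.+1) w by move=> [].
  by rewrite (memNset ND) (mem_set US') mul0r mul1r add0r.
have NS : ~ U t.+1 w by rewrite US => -[_] /=; rewrite ltNge Mw.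
have D : (U t `\` U t.+1) w by [].
by rewrite (memNset NS) (mem_set D) mul0r mul1r addr0.
Qed.

Lemma ville : measurable (U n) /\ ((1 - delta)%:E <= Pr (U n))%E.
Proof.
have mU : measurable (U n) by apply: (Fm (t := n)); exact: FU.
split=> //; have [dp d1] := andP d01.
have h : ((delta^-1)%:E * Pr (~` U n) <= 1)%E.
  apply: le_trans (inv (leqnn n)); rewrite leeDl//.
  by apply: integral_ge0 => w _; rewrite lee_fin mulr_ge0.
have mUC : measurable (~` U n) by exact: measurableC.
have fC : Pr (~` U n) \is a fin_num by exact: fin_num_measure.
have fU : Pr (U n) \is a fin_num by exact: fin_num_measure.
have := probability_setC Pr mU; move: h.
rewrite -(fineK fC) -(fineK fU) -EFinM -EFinB !lee_fin mulrC ler_pdivrMr// mul1r.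
move=> h [E]; move: h; rewrite E; lra.
Qed.

End Ville.

(** * Round-by-round updates of determinant, quadratic form and information gain *)

Section Sequential.
Variables (R : realType) (d : nat) (k : pt R d -> pt R d -> R).
Hypothesis mk : measurable_fun setT (fun z : pt R d * pt R d => k z.1 z.2).
Hypotheses (pdk : pd_kernel k) (k1 : forall x, k x x <= 1).
Local Notation prob := (probability (pt R d) R).
Variables (lam : R) (lam1 : 1 <= lam) (p : nat -> prob) (e : nat -> R).

Let lam0 : 0 < lam. Proof. exact: lt_le_trans lam1. Qed.

(** Indices start at zero: [p i] belongs to round [i + 1], so [pfam q] is the history before round
    [q + 1]. *)
Definition pfam q (i : 'I_q) : prob := p i.
Definition ridge q : 'M[R]_q := gram k (@pfam q) + lam%:M.
Definition evec q : 'rV[R]_q := \row_(i < q) e i.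
Definition pvar q P := post_var k lam (@pfam q) P.
Definition pmean q P := post_mean k lam (@pfam q) (evec q) P.
Definition quad q := dotmx (evec q *m invmx (ridge q)) (evec q).

Lemma ridge_in_unit q : ridge q \in unitmx.
Proof. by apply: ridge_unit => // v; exact: gram_psd. Qed.

Lemma ridge_tr q : (ridge q)^T = ridge q.
Proof. by apply: ridge_sym; exact: gram_sym. Qed.

Lemma pvar_ge0 q P : 0 <= pvar q P.
Proof.
apply: ridge_var_ge0 => //; first exact: gram_sym.
- by move=> v; exact: gram_psd.
- by move=> a; exact: gram_bordered_psd.
Qed.

Lemma pvar_le q P : pvar q P <= ktil k P P.
Proof.
apply: ridge_var_le => //; first exact: gram_sym.
by move=> v; exact: gram_psd.
Qed.

Lemma pvar_le1 q P : pvar q P <= 1.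
Proof.
by apply: le_trans (pvar_le q P) (le_trans (ler_norm _) _); exact: ktil_le1.
Qed.

Let s q := lam + pvar q (p q).

Let s_gt0 q : 0 < s q.
Proof. by rewrite ltr_wpDr// pvar_ge0. Qed.

Let sE q : s q = (lam + ktil k (p q) (p q)) -
  dotmx (kvec k (@pfam q) (p q) *m invmx (ridge q)) (kvec k (@pfam q) (p q)).
Proof. by rewrite /s /pvar /post_var addrA. Qed.

Let ridge_block q : ridge (q + 1) = block_mx (ridge q) (kvec k (@pfam q) (p q))^T
   (kvec k (@pfam q) (p q)) (lam + ktil k (p q) (p q))%:M.
Proof.
apply/matrixP => i j.
case: (split_ordP i) => i' ->; case: (split_ordP j) => j' ->.
- by rewrite block_mxEul !mxE (inj_eq (@lshift_inj _ _)).
- by rewrite block_mxEur !mxE eq_lrshift mulr0n addr0 /pfam /= !ord1 addn0 ktilC.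
- by rewrite block_mxEdl !mxE eq_rlshift mulr0n addr0 /pfam /= !ord1 addn0.
- by rewrite block_mxEdr !mxE !ord1 /pfam /= addn0 !eqxx !mulr1n addrC.
Qed.

Let evec_block q : evec (q + 1) = row_mx (evec q) (e q)%:M.
Proof.
apply/matrixP => i j; case: (split_ordP j) => j' ->.
  by rewrite row_mxEl !mxE.
by rewrite row_mxEr !mxE !ord1 eqxx mulr1n /= addn0.
Qed.

Lemma det_ridge_succ q : \det (ridge q.+1) = \det (ridge q) * (lam + pvar q (p q)).
Proof.
rewrite -[q.+1]addn1 ridge_block -/(s q) sE.
by apply: det_bordered; exact: ridge_in_unit.
Qed.

Lemma det_ridge_gt0 q : 0 < \det (ridge q).
Proof.
by elim: q => [|q ih]; rewrite ?det_mx00// det_ridge_succ mulr_gt0// s_gt0.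
Qed.

Lemma quad_succ q : quad q.+1 =
  quad q + (e q - pmean q (p q)) ^+ 2 / (lam + pvar q (p q)).
Proof.
rewrite -[q.+1]addn1 /quad evec_block ridge_block -/(s q) sE.
rewrite quad_bordered//; first exact: ridge_in_unit.
- exact: ridge_tr.
- by rewrite -sE gt_eqF.
Qed.

Definition mart q := expR ((dotmx (evec q) (evec q) - quad q) / 2 - ln (\det (ridge q)) / 2).

Lemma mart0 : mart 0 = 1.
Proof.
rewrite /mart /quad det_mx00 ln1 mul0r subr0 !dotmxE !big_ord0 subr0 mul0r.
exact: expR0.
Qed.

(** The factor is the value in [gaussd_mixture_integral] for mean [pmean] and variance [v], since
    [1 + v] is the Schur complement [lam + pvar]. *)
Lemma mart_succ q : let v := lam - 1 + pvar q (p q) in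
  mart q.+1 = mart q * expR ((e q ^+ 2 -
    (e q - pmean q (p q)) ^+ 2 / (1 + v)) / 2 - ln (1 + v) / 2).
Proof.
move=> v; have -> : 1 + v = lam + pvar q (p q) by rewrite /v; ring.
rewrite /mart -expRD; congr expR; rewrite quad_succ det_ridge_succ.
rewrite lnM ?posrE ?det_ridge_gt0 ?s_gt0//.
have -> : dotmx (evec q.+1) (evec q.+1) = dotmx (evec q) (evec q) + e q ^+ 2.
  by rewrite !dotmxE big_ord_recr /= !mxE expr2; congr (_ + _);
    apply: eq_bigr => i _; rewrite !mxE.
by field; rewrite gt_eqF ?s_gt0.
Qed.

Lemma det_ridge_info q :
  ln (\det (ridge q)) = q%:R * ln lam + 2 * info_gain k lam (@pfam q).
Proof.
have E : ridge q = lam *: (1%:M + lam^-1 *: gram k (@pfam q)).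
  by rewrite scalerDr scalerA divff ?gt_eqF// scale1r scalemx1 addrC.
have D0 := det_ridge_gt0 q; rewrite E detZ in D0.
have L0 : 0 < lam ^+ q by rewrite exprn_gt0.
rewrite E detZ lnM ?posrE//; last by rewrite -(pmulr_rgt0 _ L0).
by rewrite lnXn// /info_gain mulrA divff ?mul1r// mulr_natl.
Qed.

Lemma info_gain_succ q : info_gain k lam (@pfam q.+1) =
  info_gain k lam (@pfam q) + 2^-1 * ln (1 + pvar q (p q) / lam).
Proof.
have := det_ridge_info q.+1; rewrite det_ridge_succ lnM ?posrE ?det_ridge_gt0 ?s_gt0//.
rewrite det_ridge_info.
have -> : lam + pvar q (p q) = lam * (1 + pvar q (p q) / lam).
  by rewrite mulrDr mulr1 mulrCA divff ?mulr1// gt_eqF.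
rewrite lnM ?posrE// ?ltr_wpDr ?divr_ge0 ?pvar_ge0 ?ltW//.
rewrite -[q.+1%:R]natr1; lra.
Qed.

Lemma info_gain0 : info_gain k lam (@pfam 0) = 0.
Proof. by rewrite /info_gain det_mx00 ln1 mulr0. Qed.

Lemma info_gain_ge0 q : 0 <= info_gain k lam (@pfam q).
Proof.
elim: q => [|q ih]; first by rewrite info_gain0.
rewrite info_gain_succ addr_ge0// mulr_ge0// ln_ge0// lerDl.
by rewrite divr_ge0 ?pvar_ge0// ltW.
Qed.

Lemma info_gain_homo q r : (q <= r)%N ->
  info_gain k lam (@pfam q) <= info_gain k lam (@pfam r).
Proof.
elim: r => [|r ih]; first by rewrite leqn0 => /eqP ->.
rewrite leq_eqVlt => /predU1P[->//|/ih h]; apply: le_trans h _.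
rewrite info_gain_succ lerDl mulr_ge0// ln_ge0// lerDl.
by rewrite divr_ge0 ?pvar_ge0// ltW.
Qed.

(** For [x = u / lam] in [[0, 1]], [ln (1 + x) >= x / 2] and [lam <= 3] give [u <= 6 ln (1 + x)],
    which is [12] times the increment of the information gain. *)
Lemma sum_pvar_le q : lam <= 3 ->
  \sum_(i < q) pvar i (p i) <= 12 * info_gain k lam (@pfam q).
Proof.
move=> lam3; elim: q => [|q ih]; first by rewrite big_ord0 info_gain0 mulr0.
rewrite big_ord_recr info_gain_succ mulrDr; apply: lerD => //.
set u := pvar q (p q); have u0 : 0 <= u by exact: pvar_ge0.
have u1 : u <= 1 by exact: pvar_le1.
pose x := u / lam; have x0 : 0 <= x by rewrite divr_ge0// ltW.
have x1 : x <= 1 by rewrite ler_pdivrMr// mul1r (le_trans u1).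
have ux : u = x * lam by rewrite /x divfK// gt_eqF.
(* From [ln (1 + x) >= 1 - 1 / (1 + x)] and [1 + x <= 2]. *)
have lnx : x / 2 <= ln (1 + x).
  have x1' : 0 < 1 + x by lra.
  have i0 : 0 < (1 + x)^-1 by rewrite invr_gt0.
  have h : ln ((1 + x)^-1) <= (1 + x)^-1 - 1.
    have := @le_ln1Dx R ((1 + x)^-1 - 1).
    rewrite (_ : 1 + ((1 + x)^-1 - 1) = (1 + x)^-1); last by ring.
    by apply; lra.
  rewrite lnV ?posrE// in h.
  have h2 : x / 2 <= 1 - (1 + x)^-1.
    have -> : 1 - (1 + x)^-1 = x / (1 + x) by field; rewrite gt_eqF.
    by rewrite ler_wpM2l// lef_pV2 ?posrE//; lra.
  lra.
have : x * lam <= x * 3 by rewrite ler_wpM2l.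
rewrite -/x ux; lra.
Qed.

(** Crude but uniform in the measures: the set under [gamma_q] is bounded, so its [sup] is an upper
    bound. *)
Lemma info_gain_bound q : info_gain k lam (@pfam q) <= q%:R * ln 2.
Proof.
elim: q => [|q ih]; first by rewrite info_gain0 mul0r.
have -> : q.+1%:R * ln 2 = q%:R * ln 2 + ln 2 :> R.
  by rewrite -[q.+1%:R]natr1; ring.
rewrite info_gain_succ; apply: lerD => //.
have x0 : 0 <= pvar q (p q) / lam by rewrite divr_ge0 ?pvar_ge0// ltW.
have x1 : pvar q (p q) / lam <= 1.
  by rewrite ler_pdivrMr// mul1r (le_trans (pvar_le1 _ _)).
have l0 : 0 <= ln (1 + pvar q (p q) / lam) by rewrite ln_ge0// lerDl.
have : ln (1 + pvar q (p q) / lam) <= ln 2 by rewrite ler_ln ?posrE//; lra.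
lra.
Qed.

End Sequential.

(** * Measurability of matrix expressions *)

Section MatrixMeasurable.
Context {R : realType} {dT : measure_display} {T : measurableType dT}.

Lemma measurable_det n (A : T -> 'M[R]_n) :
  (forall i j, measurable_fun setT (fun w => A w i j)) ->
  measurable_fun setT (fun w => \det (A w)).
Proof.
move=> mA; apply: measurable_sum => s; apply: measurable_funM => //.
by apply: measurable_prod => i _.
Qed.

(** Cramer's rule, with [1 / det] written as [expR (- ln det)], whence the positivity of the
    determinant. *)
Lemma measurable_invmx n (A : T -> 'M[R]_n) :
  (forall w, A w \in unitmx) -> (forall w, 0 < \det (A w)) ->
  (forall i j, measurable_fun setT (fun w => A w i j)) ->
  forall i j, measurable_fun setT (fun w => invmx (A w) i j).
Proof.
move=> uA dA mA i j.
rewrite [X in measurable_fun _ X](_ : _ = (fun w => expR (- ln (\det (A w))) *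
    ((-1) ^+ (j + i) * \det (row' j (col' i (A w)))))); last first.
  by apply/funext => w; rewrite /invmx uA !mxE /cofactor expRN lnK ?posrE.
apply: measurable_funM.
  apply: measurableT_comp => //; apply: measurable_funN.
  by apply: measurableT_comp => //; exact: measurable_det.
apply: measurable_funM => //; apply: measurable_det => a b.
by under eq_fun do rewrite !mxE; exact: mA.
Qed.

Lemma measurable_mulmx m n p (A : T -> 'M[R]_(m, n)) (B : T -> 'M[R]_(n, p)) :
  (forall i j, measurable_fun setT (fun w => A w i j)) ->
  (forall i j, measurable_fun setT (fun w => B w i j)) ->
  forall i j, measurable_fun setT (fun w => (A w *m B w) i j).
Proof.
move=> mA mB i j; under eq_fun do rewrite mxE.
by apply: measurable_sum => a; exact: measurable_funM.
Qed.

End MatrixMeasurable.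

(** * Measurability of the posterior and of the supermartingale *)

Section ProcessMeasurable.
Context {R : realType} {d : nat}.
Variables (k : pt R d -> pt R d -> R).
Hypothesis mk : measurable_fun setT (fun z : pt R d * pt R d => k z.1 z.2).
Hypotheses (pdk : pd_kernel k) (k1 : forall x, k x x <= 1).
Variables (lam : R) (lam1 : 1 <= lam).
Variable Pq : pt R d -> probability (pt R d) R.
Hypothesis mPq : forall A, measurable A -> measurable_fun setT (fun x => Pq x A : \bar R).

(** Joint in both queries, as both are random; each of the two integrals is one application of
    [bmeas_kernel]. *)
Lemma measurable_ktil :
  measurable_fun setT (fun z : pt R d * pt R d => ktil k (Pq z.1) (Pq z.2)).
Proof.
have bk := bmeas_k mk pdk k1.
have b1 : bmeas (fun z : pt R d * pt R d => kmean k (Pq z.1) z.2).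
  have mP1 A : measurable A ->
      measurable_fun setT (fun z : pt R d * pt R d => Pq z.1 A : \bar R).
    by move=> mA; exact: measurableT_comp (mPq mA) _.
  apply: (bmeas_kernel mP1 (h := fun z => k z.1.2 z.2)).
  split; last by exists 1 => z; exact: kernel_norm_le1.
  exact: (measurableT_comp mk (measurable_fun_pair
    (measurableT_comp measurable_snd measurable_fst) measurable_snd)).
have mP1 A : measurable A ->
    measurable_fun setT (fun z : pt R d * pt R d => Pq z.1 A : \bar R).
  by move=> mA; exact: measurableT_comp (mPq mA) _.
have := @bmeas_kernel _ _ _ _ _ _ mP1 (fun z => kmean k (Pq z.1.2) z.2).
move=> /(_ _)[]//.
split; last first.
  by have [_ [M hM]] := b1; exists M => z; exact: (hM (z.1.2, z.2)).
exact: (measurableT_comp b1.1 (measurable_fun_pair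
    (measurableT_comp measurable_snd measurable_fst) measurable_snd)).
Qed.

Context {dT : measure_display} {T : measurableType dT}.
Variables (X : nat -> T -> pt R d) (E : nat -> T -> R) (q : nat).
Hypothesis mX : forall i, (i < q)%N -> measurable_fun setT (X i).
Hypothesis mE : forall i, (i < q)%N -> measurable_fun setT (E i).

Let p w i := Pq (X i w).
Let e w i := E i w.

Let mktil2 (Y Z : T -> pt R d) : measurable_fun setT Y -> measurable_fun setT Z ->
  measurable_fun setT (fun w => ktil k (Pq (Y w)) (Pq (Z w))).
Proof.
by move=> mY mZ; exact: measurableT_comp measurable_ktil (measurable_fun_pair mY mZ).
Qed.

Let mridge i j : measurable_fun setT (fun w => ridge k lam (p w) q i j).
Proof.
under eq_fun do rewrite !mxE.
by apply: measurable_funD => //; apply: mktil2; exact: mX.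
Qed.

Let mevec i j : measurable_fun setT (fun w => evec (e w) q i j).
Proof. by under eq_fun do rewrite mxE; exact: mE. Qed.

Let minv i j : measurable_fun setT (fun w => invmx (ridge k lam (p w) q) i j).
Proof.
apply: measurable_invmx => // w; first exact: ridge_in_unit.
exact: det_ridge_gt0.
Qed.

Let mtr m n (A : T -> 'M[R]_(m, n)) :
  (forall i j, measurable_fun setT (fun w => A w i j)) ->
  forall i j, measurable_fun setT (fun w => (A w)^T i j).
Proof. by move=> mA i j; under eq_fun do rewrite mxE; exact: mA. Qed.

(** With [T] taken as [sub_sigma (F t)] this becomes adaptedness. *)
Lemma measurable_mart : measurable_fun setT (fun w => mart k lam (p w) (e w) q).
Proof.
apply: measurableT_comp => //; apply: measurable_funB; apply: measurable_funM => //.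
  apply: measurable_funB; rewrite /quad /dotmx; apply: measurable_mulmx => //.
  - exact: mtr.
  - exact: measurable_mulmx.
  - exact: mtr.
by apply: measurableT_comp => //; exact: measurable_det.
Qed.

Variable Y : T -> pt R d.
Hypothesis mY : measurable_fun setT Y.

Let mkvec i j : measurable_fun setT (fun w => kvec k (@pfam _ _ (p w) q) (Pq (Y w)) i j).
Proof. by under eq_fun do rewrite mxE; apply: mktil2 => //; exact: mX. Qed.

(** Over [sub_sigma (F t)], with [Y] the next query, this makes the mixing variance predictable. *)
Lemma measurable_pvar : measurable_fun setT (fun w => pvar k lam (p w) q (Pq (Y w))).
Proof.
apply: measurable_funB; first exact: mktil2.
apply: measurable_mulmx; last exact: mtr.
exact: measurable_mulmx.
Qed.

Lemma measurable_pmean :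
  measurable_fun setT (fun w => pmean k lam (p w) (e w) q (Pq (Y w))).
Proof.
apply: measurable_mulmx; last exact: mtr.
exact: measurable_mulmx.
Qed.

End ProcessMeasurable.

(** * The confidence bound at an arbitrary measure *)

Section Confidence.
Variables (R : realType) (d : nat) (k : pt R d -> pt R d -> R).
Hypothesis mk : measurable_fun setT (fun z : pt R d * pt R d => k z.1 z.2).
Hypotheses (pdk : pd_kernel k) (k1 : forall x, k x x <= 1).
Local Notation prob := (probability (pt R d) R).
Variables (f : pt R d -> R) (B : R).
Hypothesis fB : rkhs_norm_le k f B.
Variables (lam : R) (lam1 : 1 <= lam) (p : nat -> prob) (y : nat -> R) (sn : R).
Hypothesis sn0 : 0 < sn.

Let B0 : 0 <= B. Proof. by case: fB. Qed.
Let lam0 : 0 < lam. Proof. exact: lt_le_trans lam1. Qed.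

(** The data are [fv + sn *: evec e q], so the error is the bias of the noiseless fit plus a noise
    term. The condition on [mart] does not involve [P], so one event serves all measures. *)
Lemma confidence q delta (P : prob) : 0 < delta < 1 -> q%:R * ln lam <= 2 ->
  mart k lam p (fun i => (y i - Exp (p i) f) / sn) q < delta^-1 ->
  `|post_mean k lam (@pfam _ _ p q) (\row_i y i) P - Exp P f| <=
  (B + sn * Num.sqrt (2 * (info_gain k lam (@pfam _ _ p q) + 1 + ln delta^-1))) *
    Num.sqrt (pvar k lam p q P).
Proof.
move=> /andP[dp d1] ql; set e := fun i => _ => hM.
have var0 : 0 <= pvar k lam p q P by exact: pvar_ge0.
set W := kvec k (@pfam _ _ p q) P *m invmx (ridge k lam p q).
pose fv : 'rV[R]_q := \row_i Exp (pfam p i) f.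
have yE : (\row_i y i) = fv + sn *: evec e q.
  apply/rowP => i; rewrite !mxE /e mulrC divfK ?gt_eqF//.
  by rewrite addrC subrK.
have -> : post_mean k lam (@pfam _ _ p q) (\row_i y i) P =
    dotmx W fv + sn * dotmx W (evec e q).
  by rewrite /post_mean -/(dotmx _ _) yE dotmxDr dotmxZr.
have bias : `|dotmx W fv - Exp P f| <= B * Num.sqrt (pvar k lam p q P).
  rewrite distrC -ler_sqr ?nnegrE ?mulr_ge0 ?sqrtr_ge0// exprMn sqr_sqrtr//.
  rewrite real_normK ?num_real//.
  apply: ridge_bias => //; first exact: gram_sym.
    by move=> v; exact: gram_psd.
  by move=> b; exact: rkhs_residual.
have noise : `|dotmx W (evec e q)| <= Num.sqrt (2 *
    (info_gain k lam (@pfam _ _ p q) + 1 + ln delta^-1)) * Num.sqrt (pvar k lam p q P).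
  have ig0 : 0 <= info_gain k lam (@pfam _ _ p q) by exact: info_gain_ge0.
  have ld : 0 <= ln delta^-1 by rewrite ln_ge0// invf_ge1// ltW.
  rewrite -ler_sqr ?nnegrE ?mulr_ge0 ?sqrtr_ge0// exprMn !sqr_sqrtr//; last lra.
  rewrite real_normK ?num_real//.
  have h := @ridge_noise _ _ (gram k (@pfam _ _ p q)) lam (gram_sym mk pdk k1 _)
    (gram_psd mk pdk k1 _) lam0 (kvec k (@pfam _ _ p q) P) (ktil k P P)
    (gram_bordered_psd mk pdk k1 _ P) (evec e q) lam1.
  apply: le_trans h _; rewrite mulrC; apply: ler_wpM2r => //.
  (* In logarithms, [|e|^2 - quad < 2 ln (1 / delta) + q ln lam + 2 info_gain], and
     [q ln lam <= 2]. *)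
  move: hM; rewrite /mart -[X in _ < X]lnK ?posrE ?invr_gt0// ltr_expR.
  rewrite det_ridge_info// /quad /ridge; lra.
have -> : dotmx W fv + sn * dotmx W (evec e q) - Exp P f =
   (dotmx W fv - Exp P f) + sn * dotmx W (evec e q) by ring.
apply: le_trans (ler_normD _ _) _; rewrite mulrDl lerD// normrM gtr0_norm//.
by rewrite -mulrA ler_wpM2l// ltW.
Qed.

Lemma Exp_norm_le (P : prob) : `|Exp P f| <= B * Num.sqrt (ktil k P P).
Proof.
have := rkhs_pairing_CS mk pdk k1 fB [:: (P, 1)].
rewrite /kform !big_seq1 /= !mul1r => h.
have K0 : 0 <= ktil k P P.
  by have := kform_ge0 mk pdk k1 [:: (P, 1)]; rewrite /kform !big_seq1 /= !mul1r.
rewrite -ler_sqr ?nnegrE ?mulr_ge0 ?sqrtr_ge0// exprMn sqr_sqrtr//.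
by rewrite real_normK ?num_real.
Qed.

End Confidence.

(** * Square-root estimates *)

Section SqrtBounds.
Variable R : realType.

Lemma sqrt_le4 (x y : R) : 0 <= x -> y <= 16 * x -> Num.sqrt y <= 4 * Num.sqrt x.
Proof.
move=> x0 yx; apply: le_trans (ler_wsqrtr yx) _.
have -> : 16 * x = 4 ^+ 2 * x by rewrite expr2 -natrM.
by rewrite sqrtrM ?sqr_ge0// sqrtr_sqr ger0_norm.
Qed.

(** Cauchy-Schwarz against the constant vector: the quadratic in [s] is [sum (sqrt (v i) - s)^2]. *)
Lemma sum_sqrt_le n (v : 'I_n -> R) : (forall i, 0 <= v i) ->
  \sum_i Num.sqrt (v i) <= Num.sqrt (n%:R * \sum_i v i).
Proof.
move=> v0; have S0 : 0 <= \sum_i v i by rewrite sumr_ge0.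
rewrite -ler_sqr ?nnegrE ?sqrtr_ge0 ?sumr_ge0//.
rewrite sqr_sqrtr ?mulr_ge0// mulrC; apply: discr_le => s.
have -> : \sum_i v i - 2 * s * (\sum_i Num.sqrt (v i)) + s ^+ 2 * n%:R =
    \sum_i (Num.sqrt (v i) - s) ^+ 2.
  have -> : s ^+ 2 * n%:R = \sum_(i < n) s ^+ 2.
    by rewrite sumr_const card_ord mulr_natr.
  rewrite mulr_sumr -sumrB -big_split; apply: eq_bigr => i _ /=.
  by rewrite sqrrB sqr_sqrtr// -mulr_natl; ring.
by rewrite sumr_ge0// => i _; exact: sqr_ge0.
Qed.

End SqrtBounds.

(** * Maximal information gain *)

Section Gamma.
Variables (R : realType) (d : nat) (k : pt R d -> pt R d -> R).
Hypothesis mk : measurable_fun setT (fun z : pt R d * pt R d => k z.1 z.2).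
Hypotheses (pdk : pd_kernel k) (k1 : forall x, k x x <= 1).
Variables (Pq : pt R d -> probability (pt R d) R) (S : set (pt R d)).
Variables (lam : R) (lam1 : 1 <= lam) (n : nat) (n0 : (0 < n)%N).

Lemma info_gain_le_gamma (zs : 'I_n -> pt R d) : (forall i, S (zs i)) ->
  info_gain k lam (fun i => Pq (zs i)) <= gamma_q k Pq S lam n.
Proof.
move=> Sz; apply: ub_le_sup; last by exists zs.
exists (n%:R * ln 2) => g [ys [Sy ->]].
(* [pfam] reads a sequence on all naturals; [insubd] sends indices from [n] on to the default
   [Ordinal n0] and fixes the first [n]. *)
have -> : (fun i => Pq (ys i)) = @pfam _ _ (fun i => Pq (ys (insubd (Ordinal n0) i))) n.
  by apply/funext => i; rewrite /pfam valKd.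
exact: info_gain_bound.
Qed.

(* The supremum is tested on the constant family [x, ..., x]. *)
Lemma ktil_le_gamma x : S x -> lam <= 3 -> gamma_q k Pq S lam n < 4^-1 ->
  n%:R * ktil k (Pq x) (Pq x) <= 12 * gamma_q k Pq S lam n.
Proof.
move=> Sx lam3; set g := gamma_q _ _ _ _ _ => g4.
set K := ktil k (Pq x) (Pq x).
have K0 : 0 <= K.
  by have := kform_ge0 mk pdk k1 [:: (Pq x, 1)]; rewrite /kform !big_seq1 /= !mul1r.
have lam0 : 0 < lam by exact: lt_le_trans lam1.
pose u := n%:R * (K / lam); have u0 : 0 <= u by rewrite mulr_ge0// divr_ge0// ltW.
have h : 2^-1 * ln (1 + u) <= g.
  have := info_gain_le_gamma (zs := fun=> x) (fun=> Sx).
  congr (_ <= _); rewrite /info_gain; congr (_ * ln _).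
  rewrite (_ : gram _ _ = K *: const_mx 1); last first.
    by apply/matrixP => i j; rewrite !mxE mulr1.
  by rewrite scalerA det_rank1 /u (mulrC _ K).
have h2 : 1 + u <= expR (2 * g).
  by rewrite -[leLHS]lnK ?posrE ?ler_expR; lra.
(* [exp (2 g) <= 1 / (1 - 2 g)] yields [u (1 - 2 g) <= 2 g]; as [g < 1/4] the factor is at least
   [1/2], so [u <= 4 g], and [lam <= 3] gives [12]. *)
have h3 : expR (2 * g) * (1 - 2 * g) <= 1.
  have := expR_ge1Dx (- (2 * g)) => h3.
  rewrite -[leRHS](expRxMexpNx_1 (2 * g)) ler_wpM2l ?expR_ge0//.
have h4 : (1 + u) * (1 - 2 * g) <= 1.
  by apply: le_trans h3; rewrite ler_wpM2r//; lra.
have h5 : 0 <= u * (2^-1 - 2 * g) by rewrite mulr_ge0//; lra.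
have h6 : u <= 4 * g by lra.
have -> : n%:R * K = u * lam by rewrite /u mulrA divfK// gt_eqF.
have h7 : u * lam <= u * 3 by rewrite ler_wpM2l.
lra.
Qed.

End Gamma.

(** * Deterministic regret bound on the good event *)

Section RegretBound.
Variables (R : realType) (d : nat) (k : pt R d -> pt R d -> R).
Hypothesis mk : measurable_fun setT (fun z : pt R d * pt R d => k z.1 z.2).
Hypotheses (pdk : pd_kernel k) (k1 : forall x, k x x <= 1).
Variables (Pq : pt R d -> probability (pt R d) R) (S : set (pt R d)).
Variables (f : pt R d -> R) (B : R).
Hypothesis fB : rkhs_norm_le k f B.
Variables (sn delta : R) (n : nat).
Hypotheses (sn0 : 0 < sn) (d01 : 0 < delta < 1) (n0 : (0 < n)%N).
Variables (Om : Type) (xs : nat -> Om -> pt R d) (ys : nat -> Om -> R) (w : Om).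
Let lam : R := 1 + 2 / n%:R.
Let p i := Pq (xs i.+1 w).
Let e i := (ys i.+1 w - Exp (p i) f) / sn.
Let gam := gamma_q k Pq S lam n.

Hypothesis Sxs : forall t, (1 <= t <= n)%N -> S (xs t w).
Hypothesis sel : forall t, (1 <= t <= n)%N -> forall x, S x ->
  ucb k lam Pq Om xs ys B sn delta t w x <=
  ucb k lam Pq Om xs ys B sn delta t w (xs t w).
Hypothesis hM : forall s, (s <= n)%N -> mart k lam p e s < delta^-1.

Let n0' : 0 < n%:R :> R. Proof. by rewrite ltr0n. Qed.
Let lam1 : 1 <= lam. Proof. by rewrite lerDl divr_ge0. Qed.
Let lam3 : lam <= 3.
Proof.
suff : 2 / n%:R <= 2 :> R by rewrite /lam; lra.
by rewrite ler_pdivrMr// ler_peMr// ler1n.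
Qed.
Let B0 : 0 <= B. Proof. by case: fB. Qed.

Let ql s : (s <= n)%N -> s%:R * ln lam <= 2.
Proof.
move=> sn'; have l2 : ln lam <= 2 / n%:R.
  by apply: le_ln1Dx; apply: lt_le_trans (divr_ge0 _ _); rewrite ?ler0n//; lra.
have l0 : 0 <= ln lam by rewrite ln_ge0.
apply: (@le_trans _ _ (n%:R * ln lam)); first by rewrite ler_wpM2r// ler_nat.
apply: (@le_trans _ _ (n%:R * (2 / n%:R))); first by rewrite ler_wpM2l.
by rewrite mulrCA divff ?mulr1// gt_eqF.
Qed.

Let sup_le t (c : R) : (1 <= t <= n)%N ->
  (forall x, S x -> Exp (Pq x) f <= c) -> sup [set Exp (Pq x) f | x in S] <= c.
Proof.
move=> tn h; apply: ge_sup; last by move=> _ [x Sx <-]; exact: h.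
by exists (Exp (Pq (xs t w)) f); exists (xs t w) => //; exact: Sxs.
Qed.

(** The value of [beta_t] at round [i + 1]. *)
Let beta i := B + sn * Num.sqrt (2 * (info_gain k lam (@pfam _ _ p i) + 1 + ln delta^-1)).

Let instant_regret i : (i < n)%N ->
  sup [set Exp (Pq x) f | x in S] - Exp (p i) f <=
  2 * (beta i * Num.sqrt (pvar k lam p i (p i))).
Proof.
move=> ni; have tn : (1 <= i.+1 <= n)%N by [].
have conf P := @confidence R d k mk pdk k1 f B fB lam lam1 p (fun i => ys i.+1 w) sn sn0
  i delta P d01 (ql (ltnW ni)) (hM (ltnW ni)).
rewrite lerBlDr; apply: (sup_le tn) => x Sx.
have h1 := conf (Pq x); have h2 := conf (p i); have h3 := sel tn Sx.
move: h1 h2 h3; rewrite !ler_norml -!/(beta i) /ucb /beta_t -!/(beta i) /hist_y /hist_P.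
rewrite -!/(pvar k lam p i _) -/(p i).
set u1 := post_mean _ _ _ _ (Pq x); set u2 := post_mean _ _ _ _ (p i).
set b1 := beta i * _; set b2 := beta i * _.
move=> /andP[h1 h1'] /andP[h2 h2'] h3.
have h3' : u1 + b1 <= u2 + b2 by exact: h3.
lra.
Qed.

Let gam_ge i : (i <= n)%N -> info_gain k lam (@pfam _ _ p i) <= gam.
Proof.
move=> ni; apply: le_trans (info_gain_homo mk pdk k1 lam1 p ni) _.
apply: (@info_gain_le_gamma R d k mk pdk k1 Pq S lam lam1 n n0 (fun i : 'I_n => xs i.+1 w)).
by move=> j; apply: Sxs; rewrite /= ltn_ord.
Qed.

Let gam0 : 0 <= gam.
Proof. by apply: le_trans (gam_ge (leqnn n)); exact: info_gain_ge0. Qed.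

Lemma regretE : regret Pq f S Om xs n w =
  \sum_(i < n) (sup [set Exp (Pq x) f | x in S] - Exp (p i) f).
Proof. by rewrite /regret big_add1 /= big_mkord. Qed.

(** When [gam >= 1/4] the constant is the product of [2] from the confidence width, [4] from
    [beta i <= 4 D] and [4] from the sum of posterior deviations; the other case gives [8]. *)
Lemma regret_bound : regret Pq f S Om xs n w <=
  32 * Num.sqrt (n%:R * gam) * (B + sn * Num.sqrt (gam + ln delta^-1)).
Proof.
have L0 : 0 <= ln delta^-1.
  by case/andP: d01 => dp d1; rewrite ln_ge0// invf_ge1// ltW.
have X0 : 0 <= Num.sqrt (n%:R * gam) by exact: sqrtr_ge0.
have Y0 : 0 <= Num.sqrt (gam + ln delta^-1) by exact: sqrtr_ge0.
have ng0 : 0 <= n%:R * gam by rewrite mulr_ge0.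
have sY0 : 0 <= sn * Num.sqrt (gam + ln delta^-1) by rewrite mulr_ge0// ltW.
rewrite regretE; have [g4|g4] := ltP gam 4^-1.
  (* The target has no additive [1] under its root, so this case cannot come
     from [instant_regret]; it follows from [|E_P f| <= B |mu_P|] alone. *)
  have kb x : S x -> `|Exp (Pq x) f| <= B * Num.sqrt (12 * gam / n%:R).
    move=> Sx; apply: le_trans (Exp_norm_le mk pdk k1 fB (Pq x)) _.
    rewrite ler_wpM2l//; apply: ler_wsqrtr; rewrite ler_pdivlMr// mulrC.
    exact: ktil_le_gamma.
  have h (i : 'I_n) : sup [set Exp (Pq x) f | x in S] - Exp (p i) f <=
      2 * (B * Num.sqrt (12 * gam / n%:R)).
    have tn : (1 <= i.+1 <= n)%N by rewrite /= ltn_ord.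
    rewrite lerBlDr; apply: (sup_le tn) => x Sx.
    have := kb _ Sx; have := kb _ (Sxs tn); rewrite -/(p i) !ler_norml; lra.
  apply: (le_trans (ler_sum _ (fun i _ => h i))).
  rewrite sumr_const card_ord -[leLHS]mulr_natl.
  have nE : n%:R * Num.sqrt (12 * gam / n%:R) = Num.sqrt (12 * (n%:R * gam)).
    have nn : n%:R = Num.sqrt (n%:R ^+ 2) :> R by rewrite sqrtr_sqr ger0_norm.
    rewrite [X in X * _]nn -sqrtrM ?sqr_ge0//.
    by congr Num.sqrt; field; rewrite gt_eqF.
  have h4 : Num.sqrt (12 * (n%:R * gam)) <= 4 * Num.sqrt (n%:R * gam).
    by apply: sqrt_le4 => //; lra.
  have -> : n%:R * (2 * (B * Num.sqrt (12 * gam / n%:R))) =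
     2 * B * (n%:R * Num.sqrt (12 * gam / n%:R)) by ring.
  rewrite nE.
  have h5 : 2 * B * Num.sqrt (12 * (n%:R * gam)) <= 2 * B * (4 * Num.sqrt (n%:R * gam)).
    by rewrite ler_wpM2l// mulr_ge0.
  apply: le_trans h5 _; rewrite mulrDr.
  have : 0 <= Num.sqrt (n%:R * gam) * B by rewrite mulr_ge0.
  have : 0 <= Num.sqrt (n%:R * gam) * (sn * Num.sqrt (gam + ln delta^-1)).
    by rewrite mulr_ge0.
  lra.
(* Now [1 <= 4 gam], so the radicand in [beta i] is at most [10 gam + 2 ln (1 / delta)], below [16]
   times that of the target. *)
pose D := B + sn * Num.sqrt (gam + ln delta^-1).
have bb (i : 'I_n) : beta i <= 4 * D.
  have h : Num.sqrt (2 * (info_gain k lam (@pfam _ _ p i) + 1 + ln delta^-1)) <=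
      4 * Num.sqrt (gam + ln delta^-1).
    apply: sqrt_le4; first exact: addr_ge0.
    have := gam_ge (ltnW (ltn_ord i)); lra.
  have : sn * Num.sqrt (2 * (info_gain k lam (@pfam _ _ p i) + 1 + ln delta^-1)) <=
      sn * (4 * Num.sqrt (gam + ln delta^-1)) by rewrite ler_wpM2l// ltW.
  have := B0; rewrite /beta /D; lra.
have D0 : 0 <= D by rewrite addr_ge0.
have v0 (i : 'I_n) : 0 <= pvar k lam p i (p i) by exact: pvar_ge0.
have h (i : 'I_n) : sup [set Exp (Pq x) f | x in S] - Exp (p i) f <=
    8 * D * Num.sqrt (pvar k lam p i (p i)).
  apply: le_trans (instant_regret (ltn_ord i)) _.
  have : beta i * Num.sqrt (pvar k lam p i (p i)) <=
     4 * D * Num.sqrt (pvar k lam p i (p i)) by rewrite ler_wpM2r// sqrtr_ge0.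
  lra.
apply: (le_trans (ler_sum _ (fun i _ => h i))); rewrite -mulr_sumr.
have hs : \sum_(i < n) Num.sqrt (pvar k lam p i (p i)) <= 4 * Num.sqrt (n%:R * gam).
  apply: le_trans (sum_sqrt_le v0) _; apply: sqrt_le4 => //.
  rewrite mulrCA ler_wpM2l//.
  apply: (le_trans (sum_pvar_le mk pdk k1 lam1 p n lam3)).
  have := gam_ge (leqnn n); have := gam0; lra.
have : 8 * D * (\sum_(i < n) Num.sqrt (pvar k lam p i (p i))) <=
    8 * D * (4 * Num.sqrt (n%:R * gam)) by rewrite ler_wpM2l// mulr_ge0.
rewrite -/D; move=> h1; apply: le_trans h1 _.
by rewrite le_eqVlt; apply/orP; left; apply/eqP; ring.
Qed.

End RegretBound.

(** * Assembly: adaptedness, the supermartingale step and the good event *)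

Theorem theorem2 :
  forall R : realType, exists C : R, 0 < C /\
  forall (d : nat) (S : set (pt R d)) (k : pt R d -> pt R d -> R)
    (Pq : pt R d -> probability (pt R d) R) (f : pt R d -> R)
    (B delta sig_q sig_z : R) (n : nat)
    (dO : measure_display) (Om : measurableType dO) (Pr : probability Om R)
    (F : nat -> set (set Om))
    (xs : nat -> Om -> pt R d) (xt : nat -> Om -> pt R d)
    (zeta : nat -> Om -> R) (Q : nat -> Om -> probability R R),
  (* S compact; k continuous bounded positive-definite kernel, k(x,x) <= 1 *)
  compact (@rv_of R d @` S) ->
  continuous (fun p : 'rV[R]_d * 'rV[R]_d => k (pt_of p.1) (pt_of p.2)) ->
  pd_kernel k -> (forall x, k x x <= 1) ->
  (* x |-> P^q_x is a (measurable) Markov kernel *)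
  (forall A, measurable A -> measurable_fun setT (fun x => Pq x A : \bar R)) ->
  0 < delta < 1 -> rkhs_norm_le k f B -> (1 <= n)%N ->
  0 < sig_q -> 0 <= sig_z ->
  (* Delta f_{P^q_x} is sigma_q-sub-Gaussian for every x in S *)
  (forall x, S x -> forall l : R,
     (\int[Pq x]_z (expR (l * (f z - Exp (Pq x) f)))%:E
        <= (expR (l ^+ 2 * sig_q ^+ 2 / 2))%:E)%E) ->
  (* F t = information available after round t (filtration) *)
  (forall t, sigma_algebra setT (F t)) ->
  (forall t, F t `<=` measurable) ->
  (forall t, F t `<=` F t.+1) ->
  (* round t: x_t is chosen from the past, x~_t and zeta_t are revealed *)
  (forall t, (1 <= t <= n)%N ->
     G_meas (F t.-1) (xs t) /\ G_meas (F t) (xt t) /\ G_meas (F t) (zeta t)) ->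
  (* Q t w = conditional law of zeta_t given the past: sigma_zeta-sub-Gaussian *)
  (forall t, (1 <= t <= n)%N ->
     (forall A, measurable A -> G_meas (F t.-1) (fun w => Q t w A : \bar R)) /\
     (forall w, subgauss_law (Q t w) sig_z)) ->
  (* given the past, x~_t ~ P^q_{x_t} and zeta_t ~ Q t, conditionally independent *)
  (forall t, (1 <= t <= n)%N -> forall E, F t.-1 E ->
     forall A A', measurable A -> measurable A' ->
     Pr (E `&` xt t @^-1` A `&` zeta t @^-1` A')
       = (\int[Pr]_(w in E) (Pq (xs t w) A * Q t w A'))%E) ->
  let lam : R := 1 + 2 / n%:R in
  let sig_nu := Num.sqrt (sig_q ^+ 2 + sig_z ^+ 2) in
  let ys := fun t w => f (xt t w) + zeta t w in
  (* ideal uGP-UCB selection rule (any tie-breaking) *)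
  (forall t, (1 <= t <= n)%N -> forall w,
     S (xs t w) /\
     forall x, S x ->
       ucb k lam Pq Om xs ys B sig_nu delta t w x
         <= ucb k lam Pq Om xs ys B sig_nu delta t w (xs t w)) ->
  let gam := gamma_q k Pq S lam n in
  exists E : set Om, measurable E /\
    E `<=` [set w | regret Pq f S Om xs n w
                    <= C * Num.sqrt (n%:R * gam)
                         * (B + sig_nu * Num.sqrt (gam + ln delta^-1))] /\
    ((1 - delta)%:E <= Pr E)%E.
Proof.
move=> R; exists 32; split=> //.
move=> d S k Pq f B delta sig_q sig_z n dO Om Pr F xs xt zeta Q _ ck pdk k1 mPq d01.
move=> fB n1 sq0 sz0 subP sF Fm Fmon adapt hQ joint lam sn ys sel gam.
have mk := measurable_continuous_kernel ck.
have bf := rkhs_bmeas mk pdk k1 fB.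
have lamgt1 : 1 < lam by rewrite ltrDl divr_gt0// ltr0n.
have lam1 := ltW lamgt1.
have sn2 : sn ^+ 2 = sig_q ^+ 2 + sig_z ^+ 2.
  by rewrite sqr_sqrtr// addr_ge0// sqr_ge0.
have sn0 : 0 < sn by rewrite sqrtr_gt0 ltr_wpDr ?sqr_ge0// exprn_gt0.
pose p w i := Pq (xs i.+1 w).
pose e w i := (ys i.+1 w - Exp (p w i) f) / sn.
pose M t w := mart k lam (p w) (e w) t.
have Fle s t : (s <= t)%N -> F s `<=` F t.
  elim: t => [|t ih]; first by rewrite leqn0 => /eqP ->.
  by rewrite leq_eqVlt => /predU1P[->//|/ih h]; exact: (subset_trans h (Fmon t)).
have Gle s t dT (T : measurableType dT) (g : Om -> T) : (s <= t)%N ->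
    G_meas (F s) g -> measurable_fun setT (g : sub_sigma (F t) -> T).
  by move=> st h; apply/(G_measP (sF t)) => A mA; exact: (Fle _ _ st _ (h _ mA)).
have mxs i t : (i < n)%N -> (i <= t)%N ->
    measurable_fun setT (xs i.+1 : sub_sigma (F t) -> pt R d).
  by move=> ni it; have [h _] := adapt i.+1 ni; exact: (Gle i t).
have me i t : (i < n)%N -> (i < t)%N ->
    measurable_fun setT ((fun w => e w i) : sub_sigma (F t) -> R).
  move=> ni it; have [_ [hx hz]] := adapt i.+1 ni.
  apply: measurable_funM => //; apply: measurable_funB.
    apply: measurable_funD; last exact: (Gle i.+1 t).
    exact: (measurableT_comp bf.1 (Gle i.+1 t _ _ _ it hx)).
  exact: (measurableT_comp (measurable_Exp mPq bf) (mxs i t ni (ltnW it))).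
have mM t : (t <= n)%N -> measurable_fun setT (M t : sub_sigma (F t) -> R).
  move=> tn; have := @measurable_mart R d k mk pdk k1 lam lam1 Pq mPq _
    (sub_sigma (F t)) (fun i => xs i.+1) (fun i w => e w i) t.
  apply=> i it.
    by apply: mxs; [exact: leq_trans it tn|exact: ltnW].
  by apply: me => //; exact: leq_trans it tn.
have M_ge0 t w : 0 <= M t w by exact: expR_ge0.
have M0 w : M 0 w = 1 by exact: mart0.
have step t E : (t < n)%N -> F t E ->
    (\int[Pr]_w (\1_E w * M t.+1 w)%:E <= \int[Pr]_w (\1_E w * M t w)%:E)%E.
  move=> tn FE; have [hx [hxt hz]] := adapt t.+1 tn.
  have [mQ subQ] := hQ t.+1 tn.
  have mxt : measurable_fun setT (xt t.+1).
    by move=> _ A mA; rewrite setTI; apply: (Fm t.+1); exact: hxt.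
  have mz : measurable_fun setT (zeta t.+1).
    by move=> _ A mA; rewrite setTI; apply: (Fm t.+1); exact: hz.
  (* The query of round [t + 1] is already [F t]-measurable, so its posterior mean and variance are
     known before [e w t] is drawn. *)
  have mxst := mxs t t tn (leqnn t).
  (* [subP] speaks of points of [S], and [sel] places the query in [S] for every [w]. *)
  have subPw w l := subP (xs t.+1 w) (sel t.+1 tn w).1 l.
  have sg := @cond_subgauss R d dO Om Pr (F t) (sF t) (Fm t) Pq (Q t.+1) (xs t.+1)
    (xt t.+1) (zeta t.+1) f sig_q sig_z mPq mxst mxt mz mQ bf subPw subQ
    (joint t.+1 tn) sn sn0 sn2.
  have mXt i : (i < t)%N -> measurable_fun setT (xs i.+1 : sub_sigma (F t) -> pt R d).
    by move=> it; apply: mxs; [exact: ltn_trans it tn|exact: ltnW].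
  have mEt i : (i < t)%N -> measurable_fun setT ((fun w => e w i) : sub_sigma (F t) -> R).
    by move=> it; apply: me => //; exact: ltn_trans it tn.
  have mv := @measurable_pvar R d k mk pdk k1 lam lam1 Pq mPq _ (sub_sigma (F t))
    (fun i => xs i.+1) t mXt _ mxst.
  have mm := @measurable_pmean R d k mk pdk k1 lam lam1 Pq mPq _ (sub_sigma (F t))
    (fun i => xs i.+1) (fun i w => e w i) t mXt mEt _ mxst.
  (* The indicator of the test event is absorbed into the weight [Z]. *)
  have := @mixture_step R dO Om Pr (F t) (sF t) (Fm t) (fun w => e w t)
    (fun w => pmean k lam (p w) (e w) t (p w t))
    (fun w => lam - 1 + pvar k lam (p w) t (p w t))
    (fun w => \1_E w * M t w).
  have -> : (\int[Pr]_w (\1_E w * M t.+1 w)%:E = \int[Pr]_w (\1_E w * M t w *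
      expR ((e w t ^+ 2 - (e w t - pmean k lam (p w) (e w) t (p w t)) ^+ 2 /
        (1 + (lam - 1 + pvar k lam (p w) t (p w t)))) / 2 -
        ln (1 + (lam - 1 + pvar k lam (p w) t (p w t))) / 2))%:E)%E.
    by apply: eq_integral => w _; rewrite /M mart_succ// mulrA.
  apply.
  - exact: (measurable_sub_sigma (sF t.+1) (Fm t.+1) (me t t.+1 tn (leqnn _))).
  - exact: mm.
  - by apply: measurable_funD => //; exact: mv.
  - apply: measurable_funM; last by apply: mM; exact: ltnW.
    by apply: measurable_indic; rewrite sub_sigmaE.
  - by move=> w; rewrite ltr_pwDl ?subr_gt0//; exact: pvar_ge0.
  - by move=> w; rewrite mulr_ge0.
  - by move=> th E' FE'; exact: sg.
have [mU PU] := ville sF Fm Fmon M0 M_ge0 mM step d01.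
exists [set w | forall s, (s <= n)%N -> M s w < delta^-1]; split=> //; split=> // w hw.
apply: regret_bound => //; first by move=> t tn; exact: (sel t tn w).1.
  by move=> t tn x Sx; exact: (sel t tn w).2.
exact: hw.
Qed.
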